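(* Let $X=\widehat{\mathbb C}\setminus\bigcup_{i\in\mathbb N}p_i$ and $Y=\widehat{\mathbb C}\setminus\bigcup_{i\in\mathbb N}q_i$ be Sierpiński packings such that the peripheral continua of $X$ are uniformly fat closed Jordan regions or points and the peripheral continua of $Y$ are closed Jordan regions or points with diameters lying in $\ell^2(\mathbb N)$. Let $h\colon\mathcal E(X)\to\mathcal E(Y)$ be a packing-$K$-quasiconformal map for some $K\ge1$. Let $H\colon\widehat{\mathbb C}\to\widehat{\mathbb C}$ be a continuous, surjective, and monotone map such that $\pi_Y\circ H=h\circ\pi_X$ and $H^{-1}(\operatorname{int}(q_i))=\operatorname{int}(p_i)$ for each $i\in\mathbb N$, and suppose there is a non-negative Borel function $\rho_H\in L^2(\widehat{\mathbb C})$ such that (1) there exists a curve family $\Gamma_0$ in $\widehat{\mathbb C}$ with $\operatorname{Mod}_2\Gamma_0=0$ such that for all curves $\gamma\colon[a,b]\to\widehat{\mathbb C}$ outside $\Gamma_0$, $$\sigma(H(\gamma(a)),H(\gamma(b)))\le\int_\gamma\rho_H\,ds+\sum_{i:\,p_i\cap|\gamma|\ne\emptyset}\operatorname{diam}(q_i);$$ (2) for each Borel set $E\subset\widehat{\mathbb C}$, $\int_{H^{-1}(E)}\rho_H^2\,d\Sigma\le K\,\Sigma(E\cap Y)$. Then for each $i\in\mathbb N$ and for each continuum $E\subset H^{-1}(q_i)\setminus p_i$ the map $H|_E$ is constant.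
   Context: $\widehat{\mathbb C}$ is the Riemann sphere with spherical metric $\sigma$ and spherical measure $\Sigma$; $\operatorname{diam}$, $\operatorname{dist}$ and balls $B(x,r)$ are with respect to $\sigma$. A continuum is a (nonempty) compact connected set; points are allowed. A Sierpiński packing is a set $X=\widehat{\mathbb C}\setminus\bigcup_{i\in\mathbb N}p_i$, where $\{p_i\}_{i\in\mathbb N}$ (the peripheral continua, part of the data) are pairwise disjoint continua, none of which separates $\widehat{\mathbb C}$, with $\operatorname{diam}(p_i)\to0$. A closed Jordan region is the closure of a region bounded by a Jordan curve. A measurable set $K'\subset\widehat{\mathbb C}$ is $\tau$-fat if for each $x\in K'$ and each ball $B(x,r)$ not containing $K'$, $\Sigma(B(x,r)\cap K')\ge\tau r^2$; sets are uniformly fat if they are all $\tau$-fat for a common $\tau>0$. A continuous map is monotone if preimages of points are continua. $\mathcal E(X)=\widehat{\mathbb C}/\{p_i\}_{i\in\mathbb N}$ is the quotient obtained by collapsing each $p_i$ to a point, $\pi_X$ is the projection, $\widehat p_i=\pi_X(p_i)$; similarly $\mathcal E(Y),\pi_Y,\widehat q_i$. A continuous, surjective, monotone map $h\colon\mathcal E(X)\to\mathcal E(Y)$ with $h(\widehat p_i)=\widehat q_i$ for each $i$ is packing-$K$-quasiconformal if there is a non-negative Borel $\rho_h\in L^2(\widehat{\mathbb C})$ such that: there is a curve family $\Gamma_0$ with $\operatorname{Mod}_2\Gamma_0=0$ such that for all curves $\gamma\colon[a,b]\to\widehat{\mathbb C}$ outside $\Gamma_0$, $$\operatorname{dist}\big(\pi_Y^{-1}\circ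 h\circ\pi_X(\gamma(a)),\ \pi_Y^{-1}\circ h\circ\pi_X(\gamma(b))\big)\le\int_\gamma\rho_h\,ds+\sum_{i:\,p_i\cap|\gamma|\ne\emptyset}\operatorname{diam}(q_i);$$ and for each Borel $E\subset\widehat{\mathbb C}$, $\int_{\pi_X^{-1}(h^{-1}(\pi_Y(E)))}\rho_h^2\,d\Sigma\le K\,\Sigma(E\cap Y)$. $|\gamma|$ is the trace of $\gamma$, and $\operatorname{Mod}_2\Gamma=\inf_\rho\int\rho^2\,d\Sigma$ over Borel $\rho\colon\widehat{\mathbb C}\to[0,\infty]$ with $\int_\gamma\rho\,ds\ge1$ for each locally rectifiable $\gamma\in\Gamma$. *)

(* Defs.v *)
From HB Require Import structures.
From mathcomp Require Import all_boot all_order all_algebra.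
From mathcomp Require Import generic_quotient.
From mathcomp Require Import all_classical all_reals all_analysis.
From mathcomp Require Import measurable_realfun.
From mathcomp Require Import ring lra.

Set Implicit Arguments.
Unset Strict Implicit.
Unset Printing Implicit Defensive.

Import Order.TTheory GRing.Theory Num.Theory.
Import numFieldNormedType.Exports.

Local Open Scope classical_set_scope.
Local Open Scope ring_scope.

Section great_circle_distance.
Context {R : realType}.
Implicit Types u v w : R * R * R.

Definition dot3 u v : R := u.1.1 * v.1.1 + u.1.2 * v.1.2 + u.2 * v.2.

Lemma dot3C u v : dot3 u v = dot3 v u.
Proof. by rewrite /dot3; ring. Qed.

Lemma dot3_itv u v : dot3 u u = 1 -> dot3 v v = 1 -> -1 <= dot3 u v <= 1.
Proof.
case: u v => [[a b] c] [[d e] f]; rewrite /dot3 /= => hu hv.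
have h1 : 0 <= (a - d) ^+ 2 + (b - e) ^+ 2 + (c - f) ^+ 2.
  by rewrite !addr_ge0 ?sqr_ge0.
have h2 : 0 <= (a + d) ^+ 2 + (b + e) ^+ 2 + (c + f) ^+ 2.
  by rewrite !addr_ge0 ?sqr_ge0.
by apply/andP; split; lra.
Qed.

Lemma dot3_eq1 u v : dot3 u u = 1 -> dot3 v v = 1 -> dot3 u v = 1 -> u = v.
Proof.
case: u v => [[a b] c] [[d e] f]; rewrite /dot3 /= => hu hv huv.
have /eqP : (a - d) ^+ 2 + (b - e) ^+ 2 + (c - f) ^+ 2 = 0 by lra.
rewrite !paddr_eq0 ?addr_ge0 ?sqr_ge0 // !sqrf_eq0 !subr_eq0.
by move=> /andP[/andP[/eqP -> /eqP ->] /eqP ->].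
Qed.

Lemma dot3_gram u v w : dot3 u u = 1 -> dot3 v v = 1 -> dot3 w w = 1 ->
  (dot3 u w - dot3 u v * dot3 v w) ^+ 2 <=
  (1 - dot3 u v ^+ 2) * (1 - dot3 v w ^+ 2).
Proof.
move=> hu hv hw.
pose det := u.1.1 * (v.1.2 * w.2 - v.2 * w.1.2)
          - u.1.2 * (v.1.1 * w.2 - v.2 * w.1.1)
          + u.2 * (v.1.1 * w.1.2 - v.1.2 * w.1.1).
have E : det ^+ 2 =
    dot3 u u * (dot3 v v * dot3 w w - dot3 v w ^+ 2)
    - dot3 u v * (dot3 u v * dot3 w w - dot3 v w * dot3 u w)
    + dot3 u w * (dot3 u v * dot3 v w - dot3 v v * dot3 u w).
  by rewrite /det /dot3; ring.
have : 0 <= det ^+ 2 by exact: sqr_ge0.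
by rewrite E hu hv hw; lra.
Qed.

Lemma acos_dot3_triangle u v w :
  dot3 u u = 1 -> dot3 v v = 1 -> dot3 w w = 1 ->
  acos (dot3 u w) <= acos (dot3 u v) + acos (dot3 v w).
Proof.
move=> hu hv hw.
have a1 := dot3_itv hu hv; have b1 := dot3_itv hv hw; have c1 := dot3_itv hu hw.
set a := dot3 u v in a1 *; set b := dot3 v w in b1 *.
set c := dot3 u w in c1 *.
have [le_pi|/ltW gt_pi] := leP (acos a + acos b) pi; last first.
  by rewrite (le_trans (acos_lepi c1)).
have c_itv : acos c \in `[0, pi] by rewrite in_itv /= acos_ge0 ?acos_lepi.
have ab_itv : acos a + acos b \in `[0, pi].
  by rewrite in_itv /= le_pi addr_ge0 ?acos_ge0.
rewrite leNgt -(ltr_cos ab_itv c_itv) -leNgt.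
rewrite cosD !acosK ?in_itv //= !sin_acos //.
have a0 : 0 <= 1 - a ^+ 2 by case/andP: a1 => *; nra.
rewrite -sqrtrM // lerBlDl -lerBlDr.
have g : (c - a * b) ^+ 2 <= (1 - a ^+ 2) * (1 - b ^+ 2).
  exact: dot3_gram hu hv hw.
rewrite (le_trans (ler_norm _)) // distrC -sqrtr_sqr.
by rewrite ler_sqrt // (le_trans _ g) ?sqr_ge0.
Qed.

End great_circle_distance.

(* The complex plane is identified with R * R, and None is the point at
   infinity. *)
Definition sphere (R : realType) : Type := option (R * R).

Section sphere_metric.
Context {R : realType}.
Implicit Types x y z : sphere R.

(* Inverse stereographic projection onto the unit sphere of R^3. *)
Definition stereo z : R * R * R :=
  if z is Some (x, y) then
    let s := 1 + x ^+ 2 + y ^+ 2 in (2 * x / s, 2 * y / s, (s - 2) / s)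
  else (0, 0, 1).

(* The geodesic distance of the length element 2|dz| / (1 + |z|^2). *)
Definition sdist x y : R := acos (dot3 (stereo x) (stereo y)).

Lemma stereo_den_gt0 (x y : R) : 0 < 1 + x ^+ 2 + y ^+ 2.
Proof. by have := sqr_ge0 x; have := sqr_ge0 y; lra. Qed.

Lemma stereo_unit z : dot3 (stereo z) (stereo z) = 1.
Proof.
case: z => [[x y]|]; rewrite /dot3 /stereo /=; last by ring.
have /lt0r_neq0 s0 := stereo_den_gt0 x y.
by field.
Qed.

Lemma stereo_inj : injective stereo.
Proof.
have s0 (x y : R) := lt0r_neq0 (stereo_den_gt0 x y).
have third (x y : R) (s := 1 + x ^+ 2 + y ^+ 2) : (s - 2) / s = 1 - 2 / s.
  by rewrite mulrBl divff ?s0.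
have pos (x y : R) : 0 < 2 / (1 + x ^+ 2 + y ^+ 2).
  by rewrite divr_gt0 ?stereo_den_gt0.
move=> [[x y]|] [[x' y']|] //=; rewrite ?third; first last.
- by move=> [_ _ h]; exfalso; have := pos x' y'; lra.
- by move=> [_ _ h]; exfalso; have := pos x y; lra.
move=> [hx hy h].
have : 2 / (1 + x ^+ 2 + y ^+ 2) = 2 / (1 + x' ^+ 2 + y' ^+ 2) by lra.
move=> /(mulfI _) -/(_ (lt0r_neq0 (ltr0n _ 2)))/invr_inj sE.
rewrite sE in hx hy.
have inv0 : (1 + x' ^+ 2 + y' ^+ 2)^-1 != 0 by rewrite invr_eq0 s0.
have two0 : (2 : R) != 0 by rewrite pnatr_eq0.
by rewrite (mulfI two0 (mulIf inv0 hx)) (mulfI two0 (mulIf inv0 hy)).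
Qed.

Lemma sdistxx x : sdist x x = 0.
Proof. by rewrite /sdist stereo_unit acos1. Qed.

Lemma sdist_eq0 x y : sdist x y = 0 -> x = y.
Proof.
move=> h; apply: stereo_inj; apply: dot3_eq1; rewrite ?stereo_unit //.
rewrite -(acosK (x := dot3 _ _)).
  by rewrite -/(sdist x y) h cos0.
by rewrite in_itv /= dot3_itv ?stereo_unit.
Qed.

Lemma sdist_sym x y : sdist x y = sdist y x.
Proof. by rewrite /sdist dot3C. Qed.

Lemma sdist_triangle y x z : sdist x z <= sdist x y + sdist y z.
Proof. by apply: acos_dot3_triangle; exact: stereo_unit. Qed.

HB.instance Definition _ := Choice.copy (sphere R) (option (R * R)).
HB.instance Definition _ := isPointed.Build (sphere R) None.
HB.instance Definition _ := isMetric.Build R (sphere R)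
  sdistxx sdist_eq0 sdist_sym sdist_triangle.

HB.instance Definition _ :=
  @isMeasurable.Build (sigma_display (@open (sphere R))) (sphere R)
    <<s @open (sphere R) >> (@sigma_algebra0 _ setT _)
    (@sigma_algebraC _ _) (@sigma_algebra_bigcup _ setT _).

End sphere_metric.

Section spherical_measure.
Context {R : realType}.

Local Notation plane := (measurableTypeR R * measurableTypeR R)%type.

Lemma plane_open_measurable (U : set (R * R)) :
  open U -> measurable (U : set plane).
Proof.
move=> oU.
pose F (i : rat * rat * nat) : set plane :=
  let B := ball (ratr i.1.1 : R, ratr i.1.2 : R) i.2.+1%:R^-1 in
  if `[< B `<=` U >] then B else set0.
have -> : U = \bigcup_i F i.
  apply/seteqP; split=> [z Uz|z [i _]]; last first.
    by rewrite /F; case: asboolP => // BU /BU.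
  have [e /= e0 eU] : exists2 e : R, 0 < e & ball z e `<=` U.
    by have /nbhs_ballP[e /= e0 eU] := open_nbhs_nbhs (conj oU Uz); exists e.
  have [n ne] : exists n, n.+1%:R^-1 < e / 2.
    have /ltr_add_invr[k] : 0 < e / 2 by rewrite divr_gt0.
    by rewrite add0r; exists k.
  have n0 : 0 < n.+1%:R^-1 :> R by rewrite invr_gt0.
  have rat_near (x : R) : exists q : rat, `|ratr q - x| < n.+1%:R^-1.
    have [q] : exists q : rat, ratr q \in `]x - n.+1%:R^-1, x + n.+1%:R^-1[.
      by apply: rat_in_itvoo; rewrite ltrBlDr -addrA ltrDl addr_gt0.
    by rewrite in_itv /= => qx; exists q; rewrite ltr_distl.
  have [p pz] := rat_near z.1; have [q qz] := rat_near z.2.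
  exists (p, q, n) => //; rewrite /F /=.
  have zB : ball (ratr p : R, ratr q : R) n.+1%:R^-1 z by split.
  rewrite asboolT // => w wB; apply: eU.
  by apply: (@le_ball _ _ _ (n.+1%:R^-1 + n.+1%:R^-1));
    [rewrite (le_trans (ltW (ltrD ne ne))) // -splitr | exact: ball_triangle (ball_sym zB) wB].
apply: countable_bigcupT_measurable => // i; rewrite /F /=.
case: asboolP => // _.
rewrite (_ : ball _ _ = ball (ratr i.1.1 : R) i.2.+1%:R^-1 `*`
                        ball (ratr i.1.2 : R) i.2.+1%:R^-1) //.
by rewrite !ball_itv; apply: measurableX; exact: measurable_itv.
Qed.

Lemma stereo_den_continuous :
  continuous (fun z : R * R => 1 + z.1 ^+ 2 + z.2 ^+ 2).
Proof.
move=> z; have c1 : {for z, continuous (fun w : R * R => w.1)}.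
  exact: cvg_fst.
have c2 : {for z, continuous (fun w : R * R => w.2)} by exact: cvg_snd.
apply: cvgD; last exact: (continuous_comp c2 (@exprn_continuous _ 2 _)).
apply: cvgD; first exact: cvg_cst.
exact: (continuous_comp c1 (@exprn_continuous _ 2 _)).
Qed.

Lemma Some_continuous : continuous (Some : R * R -> sphere R).
Proof.
move=> z; apply/cvg_ballP => e e0.
pose f w := dot3 (stereo (Some z)) (stereo (Some w)).
pose d := Num.min e pi.
have d0 : 0 < d by rewrite lt_min e0 pi_gt0.
have d_itv : d \in `[0, pi] by rewrite in_itv /= ltW // ge_min lexx orbT.
have : cos d < f z.
  rewrite /f stereo_unit -cos0 ltr_cos // in_itv /= lexx.
  by rewrite (ltW (pi_gt0 _)).
have fc : {for z, continuous f}.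
  pose den (w : R * R) := 1 + w.1 ^+ 2 + w.2 ^+ 2.
  have den0 w : den w != 0 by rewrite lt0r_neq0 ?stereo_den_gt0.
  have c1 : {for z, continuous (fun w : R * R => w.1)} by exact: cvg_fst.
  have c2 : {for z, continuous (fun w : R * R => w.2)} by exact: cvg_snd.
  have cden : {for z, continuous den} by exact: stereo_den_continuous.
  have cinv : {for z, continuous (fun w => (den w)^-1)} by exact: cvgV.
  set u := stereo (Some z) in f *.
  have -> : f = fun w => u.1.1 * (2 * w.1 * (den w)^-1)
      + u.1.2 * (2 * w.2 * (den w)^-1) + u.2 * ((den w - 2) * (den w)^-1).
    by apply/funext => -[x y].
  apply: cvgD; [apply: cvgD|]; apply: (cvgM (cvg_cst _)); apply: cvgM => //.
  - exact: (cvgM (cvg_cst _)).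
  - exact: (cvgM (cvg_cst _)).
  - by apply: cvgB => //; exact: cvg_cst.
move=> /(cvgr_gt _ fc); apply: filterS => w dw.
rewrite ballEmdist /= /sdist; suff: sdist (Some z) (Some w) < d.
  by move=> /lt_le_trans; apply; rewrite ge_min lexx.
have w1 := dot3_itv (stereo_unit (Some z)) (stereo_unit (Some w)).
have w_itv : sdist (Some z) (Some w) \in `[0, pi].
  by rewrite in_itv /= acos_ge0 ?acos_lepi.
by rewrite -(ltr_cos w_itv d_itv) acosK ?in_itv.
Qed.

Lemma Some_measurable :
  measurable_fun [set: plane] (Some : plane -> sphere R).
Proof.
apply: measurability => //= _ [U oU <-]; rewrite setTI.
apply: plane_open_measurable.
by have /continuousP := Some_continuous; exact.
Qed.

(* The spherical area element in a complex coordinate; the point at infinity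
   carries no mass. *)
Definition sphere_density (z : plane) : \bar R :=
  (4 / (1 + z.1 ^+ 2 + z.2 ^+ 2) ^+ 2)%:E.

Definition sphere_measure (A : set (sphere R)) : \bar R :=
  (\int[lebesgue_measure \x lebesgue_measure]_(z in
      (Some : plane -> sphere R) @^-1` A) sphere_density z)%E.

Lemma sphere_density_ge0 z : (0 <= sphere_density z)%E.
Proof. by rewrite lee_fin divr_ge0 ?sqr_ge0. Qed.

Lemma measurable_sphere_density : measurable_fun [set: plane] sphere_density.
Proof.
apply/measurable_EFinP.
apply: (measurability _ (RGenOpens.measurableE R)).
move=> _ [_ [a [b ->] <-]]; rewrite setTI; apply: plane_open_measurable.
pose f (z : R * R) : R := 4 / (1 + z.1 ^+ 2 + z.2 ^+ 2) ^+ 2.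
suff /continuousP : continuous f by apply; exact: interval_open.
move=> z; apply: (cvgM (cvg_cst _)); apply: cvgV.
  by rewrite expf_neq0 // lt0r_neq0 ?stereo_den_gt0.
exact: (continuous_comp (@stereo_den_continuous z) (@exprn_continuous _ 2 _)).
Qed.

Let sphere_measure0 : sphere_measure set0 = 0%E.
Proof. by rewrite /sphere_measure preimage_set0 integral_set0. Qed.

Let sphere_measure_ge0 A : (0 <= sphere_measure A)%E.
Proof. by apply: integral_ge0 => z _; exact: sphere_density_ge0. Qed.

Let sphere_measure_sigma_additive : semi_sigma_additive sphere_measure.
Proof.
move=> F mF tF mUF; rewrite /sphere_measure preimage_bigcup.
apply: (semi_sigma_additive_nng_induced measurable_sphere_density
  sphere_density_ge0).
- by move=> i; rewrite -[X in measurable X]setTI; exact: Some_measurable.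
- by apply/trivIsetP => i j _ _ ij; rewrite -preimage_setI;
    move/trivIsetP : tF => -> //; rewrite preimage_set0.
- by rewrite -preimage_bigcup -[X in measurable X]setTI; exact: Some_measurable.
Qed.

HB.instance Definition _ := isMeasure.Build _ (sphere R) R sphere_measure
  sphere_measure0 sphere_measure_ge0 sphere_measure_sigma_additive.

End spherical_measure.

Section topology.

Definition continuum (T : topologicalType) (A : set T) :=
  [/\ A !=set0, compact A & connected A].

Definition monotone_map (S T : topologicalType) (f : S -> T) :=
  forall y, continuum (f @^-1` [set y]).

Definition jordan_curve (R : realType) (T : topologicalType) (J : set T) :=
  exists g : R -> T,
    [/\ {within `[0, 1], continuous g}, {in `[0, 1[ &, injective g},
        g 0 = g 1 & J = g @` `[0, 1]].

(* U is a region whose topological boundary is the Jordan curve J. *)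
Definition closed_jordan_region (R : realType) (A : set (sphere R)) :=
  exists U J : set (sphere R),
    [/\ open U, connected U, jordan_curve R J,
        closure U `\` U° = J & A = closure U].

End topology.

Section sphere_geometry.
Context {R : realType}.
Implicit Types A B : set (sphere R).

Definition diam A : R := sup [set mdist x y | x in A & y in A].

Definition set_dist A B : R := inf [set mdist x y | x in A & y in B].

Definition fat (tau : R) A :=
  measurable A /\
  forall x r, A x -> 0 < r -> ~ A `<=` ball x r ->
    ((tau * r ^+ 2)%:E <= sphere_measure (ball x r `&` A))%E.

End sphere_geometry.

Section curves.
Context {R : realType}.

(* The values of curve_fun outside [curve_start, curve_end] are irrelevant. *)
Record curve := Curve {
  curve_start : R;
  curve_end : R;
  curve_fun :> R -> sphere R;
  curve_le : curve_start <= curve_end;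
  curve_cont : {within `[curve_start, curve_end], continuous curve_fun} }.

Implicit Types (g : curve) (rho : sphere R -> \bar R) (Gamma : set curve).

Definition trace g : set (sphere R) := g @` `[curve_start g, curve_end g].

(* Length, with respect to the spherical metric, of the subcurve ending at
   parameter t. *)
Definition length_upto g (t : R) : \bar R :=
  let a := curve_start g in
  ereal_sup [set (\sum_(0 <= k < size s)
      mdist (g (nth t (a :: s) k)) (g (nth t (a :: s) k.+1)))%:E
    | s in itv_partition a t].

Definition curve_length g := length_upto g (curve_end g).

(* Parameter intervals being compact, locally rectifiable means rectifiable. *)
Definition rectifiable g := (curve_length g < +oo)%E.

(* Any parameter at which the length equals l will do, since g is constant
   between two such parameters. *)
Definition arclength_param g (l : R) : sphere R :=
  g (xget (curve_start g) [set t | t \in `[curve_start g, curve_end g] /\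
                                   length_upto g t = l%:E]).

(* The value +oo on nonrectifiable curves is a convention: by the definition
   of the modulus, the nonrectifiable curves never affect exceptional
   families. *)
Definition line_integral g rho : \bar R :=
  if curve_length g == +oo%E then +oo%E
  else (\int[lebesgue_measure]_(l in `[0%R, fine (curve_length g)])
          rho (arclength_param g l))%E.

Definition nonneg_borel rho :=
  measurable_fun [set: sphere R] rho /\ forall x, (0 <= rho x)%E.

Definition admissible Gamma rho :=
  nonneg_borel rho /\
  forall g, Gamma g -> rectifiable g -> (1 <= line_integral g rho)%E.

Definition modulus2 Gamma : \bar R :=
  ereal_inf [set (\int[@sphere_measure R]_x (rho x ^+ 2))%E
    | rho in admissible Gamma].

Definition nonneg_borel_L2 rho :=
  nonneg_borel rho /\ (\int[@sphere_measure R]_x (rho x ^+ 2) < +oo)%E.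

End curves.

Arguments curve : clear implicits.

Section packings.
Context {R : realType}.

Record sierpinski_packing := SierpinskiPacking {
  periph : nat -> set (sphere R);
  periph_trivIset : trivIset setT periph;
  periph_continuum : forall i, continuum (periph i);
  periph_nonseparating : forall i, connected (~` periph i);
  periph_diam : diam (periph i) @[i --> \oo] --> (0 : R) }.

Implicit Types X Y : sierpinski_packing.

Definition packing_set X : set (sphere R) := ~` \bigcup_i periph X i.

Definition periph_rel X : rel (sphere R) := fun x y =>
  `[< x = y \/ exists i, periph X i x /\ periph X i y >].

Lemma periph_rel_refl X : reflexive (periph_rel X).
Proof. by move=> x; apply/asboolP; left. Qed.

Lemma periph_rel_sym X : symmetric (periph_rel X).
Proof.
by move=> x y; apply/asboolP/asboolP => -[->|[i [? ?]]];
  [left | right; exists i | left | right; exists i].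
Qed.

Lemma periph_rel_trans X : transitive (periph_rel X).
Proof.
move=> y x z /asboolP[->//|[i [ix iy]]] /asboolP[<-|[j [jy jz]]];
  apply/asboolP; right; first by exists i.
have ij : i = j by apply: (@periph_trivIset X) => //; exists y.
by exists i; split=> //; rewrite ij.
Qed.

Definition periph_equiv X := EquivRel (periph_rel X)
  (periph_rel_refl X) (periph_rel_sym X) (@periph_rel_trans X).

Definition packing_quotient X := quotient_topology {eq_quot periph_equiv X}%qT.

HB.instance Definition _ X := Topological.on (packing_quotient X).

Definition packing_proj X : sphere R -> packing_quotient X :=
  (\pi_(packing_quotient X))%qT.

Definition diam_sum X Y (g : curve R) : \bar R :=
  (\esum_(i in [set i | periph X i `&` trace g !=set0])
     (diam (periph Y i))%:E)%E.

Definition packing_quasiconformal X Y (K : R)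
    (h : packing_quotient X -> packing_quotient Y) :=
  [/\ continuous h, set_surj setT setT h, monotone_map h,
      forall i, h @` (packing_proj X @` periph X i) =
                packing_proj Y @` periph Y i &
      exists rho : sphere R -> \bar R,
        [/\ nonneg_borel_L2 rho,
            exists Gamma0 : set (curve R), modulus2 Gamma0 = 0%E /\
              forall g : curve R, ~ Gamma0 g ->
              let P z := packing_proj Y @^-1` [set h (packing_proj X z)] in
              ((set_dist (P (g (curve_start g))) (P (g (curve_end g))))%:E <=
                 line_integral g rho + diam_sum X Y g)%E &
            forall E : set (sphere R), measurable E ->
              (\int[@sphere_measure R]_(x in
                  packing_proj X @^-1` (h @^-1` (packing_proj Y @` E)))
                  (rho x ^+ 2) <=
                K%:E * sphere_measure (E `&` packing_set Y))%E]].

End packings.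

Arguments sierpinski_packing : clear implicits.

(* Main.v *)
Require Import Defs.
From HB Require Import structures.
From mathcomp Require Import all_boot all_order all_algebra.
From mathcomp Require Import all_classical all_reals all_analysis.
From mathcomp Require Import measurable_realfun.
From mathcomp Require Import ring lra.

Set Implicit Arguments.
Unset Strict Implicit.
Unset Printing Implicit Defensive.

Import Order.TTheory GRing.Theory Num.Theory.
Import numFieldNormedType.Exports.

Local Open Scope classical_set_scope.
Local Open Scope ring_scope.

(* If H is not constant on E, some 1-Lipschitz f = d(H(.), w) is not constant
   on E. As q_i lies in H(p_i), each connected fibre H^-1(y), y in H(E), joins E
   to p_i; so near a point of E it crosses the boundary of every rectangle
   around that point which stays away from p_i. It therefore suffices that, on
   almost every horizontal and vertical segment avoiding p_i, the part C lying
   in H^-1(q_i) has an f-image of measure zero: then f(E) is a null interval.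
   On almost every such segment rho_H is integrable and vanishes a.e. on C, the
   upper gradient inequality holds on all subsegments, and the diameters of those
   q_j whose p_j meets the segment are summable, as fatness makes diam(p_j) square
   summable. After collapsing the intervals f(q_j), f is controlled by the
   integral of rho_H alone; hence f(C) is null up to the tail of the f(q_j),
   and C, being disjoint from every p_j, can be covered by segments that avoid
   any given finite number of them. *)

(** * An upper gradient inequality with countably many exceptional sets *)

(** The upper gradient inequality concerns generic curves, whereas E need not contain any arc and
    may lie on exceptional lines; the fibres of H serve to carry the values taken on E over to sides
    of rectangles that can be chosen generic. The distance to a point replaces H because a connected
    null subset of the line has at most one point, while a connected subset of the sphere of area
    zero can be a curve. On a generic side the obstacle is the sum of diameters. If C is covered by
    short segments, one p_j may meet many of them and diam(q_j) is then charged each time, so that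
    adding the inequalities gives no bound. For a function that is constant on p_j, one can instead
    cut the range into equal levels: p_j meets the pieces of the segment that cross at most two of
    the levels. Each diameter is then charged at most twice, and refining the levels makes the share
    of any finite number of p_j as small as desired. Collapsing the f(q_j) creates such a function,
    at the price of measuring the image only outside the f(q_j). *)

Section real_line.
Context {R : realType}.

(* [lebesgue_measure] is an outer measure on all sets, so that neither here nor
   in the statements [lebesgue_measure _ = 0] below is measurability needed. *)
Lemma le_lebesgue (A B : set R) : A `<=` B ->
  (lebesgue_measure A <= lebesgue_measure B)%E.
Proof. exact: (@le_outer_measure _ _ (((wlength (@idfun R))^*)%mu)). Qed.

Lemma compact_min (A : set R) : A !=set0 -> compact A ->
  exists2 c, A c & forall t, A t -> c <= t.
Proof.
move=> A0 cA; have [|c cA' minc] := compact_EVT_min A0 cA (f := idfun).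
  by apply: continuous_subspaceT => x; exact: cvg_id.
by exists c; [rewrite inE in cA' | move=> t At; apply: minc; rewrite inE].
Qed.

Lemma compact_max (A : set R) : A !=set0 -> compact A ->
  exists2 c, A c & forall t, A t -> t <= c.
Proof.
move=> A0 cA; have [|c cA' minc] := compact_EVT_max A0 cA (f := idfun).
  by apply: continuous_subspaceT => x; exact: cvg_id.
by exists c; [rewrite inE in cA' | move=> t At; apply: minc; rewrite inE].
Qed.

(** Take for t the first point of [a, b] with g >= v, and for s the last point of [a, t] with g <=
    u; the intermediate value theorem turns both inequalities into equalities. *)
Lemma crossing_interval (g : R -> R) a b u v :
  continuous g -> a <= b -> g a <= u -> u < v -> v <= g b ->
  exists s t, [/\ a <= s, s < t, t <= b, g s = u /\ g t = v &
    forall r, s < r < t -> u < g r < v].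
Proof.
move=> gc ab gau uv vgb.
have cl_ge x : closed [set r | x <= g r].
  exact: (@closed_comp _ _ g _ (fun z _ => gc z) (@closed_ge _ x)).
have cl_le x : closed [set r | g r <= x].
  exact: (@closed_comp _ _ g _ (fun z _ => gc z) (@closed_le _ x)).
have gw x y : {within `[x, y], continuous g} by exact: continuous_subspaceT.
have [|//|t [/= + gt] tmin] := @compact_min (`[a, b] `&` [set r | v <= g r]).
- by exists b; split => //=; rewrite in_itv /= ab lexx.
- by apply: compact_closedI (cl_ge v); exact: segment_compact.
rewrite in_itv /= => /andP[le_at le_tb].
have gtv : g t = v.
  apply/eqP; rewrite eq_le gt andbT leNgt; apply/negP => vgt.
  have [||r /itvP rat grv] := @IVT _ g a t v le_at; first exact: gw.
    by rewrite ge_min le_max (le_trans gau (ltW uv)) (ltW vgt) orbT.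
  have rt : r < t by rewrite lt_neqAle rat andbT; apply: contraTneq vgt => <-; rewrite grv ltxx.
  suff: t <= r by rewrite leNgt rt.
  apply: tmin.
  by split => /=; rewrite ?grv// in_itv /= rat (le_trans _ le_tb)// rat.
have [|//|s [/= + gs] smax] := @compact_max (`[a, t] `&` [set r | g r <= u]).
- by exists a; split => //=; rewrite in_itv /= lexx.
- by apply: compact_closedI (cl_le u); exact: segment_compact.
rewrite in_itv /= => /andP[le_as le_st].
have gsu : g s = u.
  apply/eqP; rewrite eq_le gs /= leNgt; apply/negP => gsu.
  have [||r /itvP rat gru] := @IVT _ g s t u le_st; first exact: gw.
    by rewrite ge_min le_max (ltW gsu) gtv (ltW uv) orbT.
  have rs : s < r.
    by rewrite lt_neqAle rat andbT; apply: contraTneq gsu => ->; rewrite gru ltxx.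
  suff: r <= s by rewrite leNgt rs.
  apply: smax.
  by split => /=; rewrite ?gru// in_itv /= rat (le_trans le_as)// rat.
have st : s < t.
  by rewrite lt_neqAle le_st andbT; apply: contraTneq uv => E; rewrite -gsu E gtv ltxx.
exists s, t; split => // r /andP[sr rt]; apply/andP; split; rewrite ltNge; apply/negP => h.
  suff: r <= s by rewrite leNgt sr.
  apply: smax.
  by split => //=; rewrite in_itv /= (ltW rt) (le_trans le_as (ltW sr)).
suff: t <= r by rewrite leNgt rt.
  apply: tmin.
by split => //=; rewrite in_itv /= (le_trans le_as (ltW sr)) (le_trans (ltW rt) le_tb).
Qed.

(** The intervals are closed because [hits] allows a set to touch a crossing interval at an
    endpoint; an integer x then belongs to two of them. *)
Lemma count_unit_intervals (x : R) n :
  (\sum_(k < n) (k%:R <= x <= k.+1%:R)%R <= 2)%N.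
Proof.
pose m := Num.truncn x.
have ind1 p : (\sum_(k < n) (val k == p) <= 1)%N.
  have [pn|np] := ltnP p n.
    rewrite (bigD1 (Ordinal pn))//= eqxx big1 ?addn0// => k kp.
    by apply/eqP; rewrite eqb0; apply: contra kp => /eqP kp; apply/eqP/val_inj.
  rewrite big1// => k _; apply/eqP; rewrite eqb0.
  by apply: contraTneq (ltn_ord k) => ->; rewrite -leqNgt.
apply: (@leq_trans (\sum_(k < n) ((val k == m) + (val k == m.-1)))).
  apply: leq_sum => k _; case: (boolP (_ <= _ <= _)) => // /andP[kx xk].
  have x0 : 0 <= x by rewrite (le_trans _ kx).
  have : (k <= m)%N by rewrite /m -(natrK (R := R) k); apply: Num.Theory.le_truncn.
  have : (m <= k.+1)%N by rewrite /m -(natrK (R := R) k.+1); apply: Num.Theory.le_truncn.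
  rewrite leq_eqVlt ltnS => /orP[/eqP ->|mk km]; first by rewrite eqxx addnC.
  by rewrite (_ : val k = m) ?eqxx//; apply/eqP; rewrite eqn_leq km mk.
by rewrite big_split /=; apply: (leq_add (ind1 _) (ind1 _)).
Qed.

End real_line.

Section level_sets.
Context {R : realType}.

Definition hits (T : nat -> set R) (x y : R) : set nat :=
  [set j | T j `&` `[x, y] !=set0].

Lemma hits_sumE (T : nat -> set R) (d : nat -> R) x y :
  (forall j, 0 <= d j) ->
  (\esum_(j in hits T x y) (d j)%:E =
   \sum_(j <oo) (if `[< hits T x y j >] then d j else 0)%:E)%E.
Proof.
move=> d0.
rewrite [in LHS](_ : hits T x y = [set j | `[< hits T x y j >]]); last first.
  by apply/seteqP; split=> j /= => [?|/asboolP//]; apply/asboolP.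
rewrite -nneseries_esum; last by move=> j _; rewrite lee_fin.
rewrite eseries_mkcond; apply: eq_eseriesr => j _.
by case: ifP.
Qed.

Variables (g : R -> R) (nu : {measure set (measurableTypeR R) -> \bar R}).
Variables (T : nat -> set R) (d : nat -> R) (a b : R).
Hypotheses (gc : continuous g) (d0 : forall j, 0 <= d j).
Hypothesis dfin : (\sum_(j <oo) (d j)%:E < +oo)%E.
Hypothesis gT : forall j s t, T j s -> T j t -> g s = g t.
Hypothesis gnu : forall x y, a <= x -> x <= y -> y <= b ->
  (`|g x - g y|%:E <= nu `]x, y[%classic + \esum_(j in hits T x y) (d j)%:E)%E.
Hypothesis ab : a <= b.

(* A set [T j] on which g is constant meets at most two of the n level
   crossing intervals, hence the factors 2. *)
Lemma level_bound_approx N n : g a < g b -> (0 < n)%N ->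
  ((g b - g a)%:E <= ((g b - g a) / n%:R * 2 *+ N)%:E + nu `]a, b[%classic
                     + 2%:E * \sum_(N <= j <oo) (d j)%:E)%E.
Proof.
set D := g b - g a => gab n0.
have D0 : 0 < D by rewrite subr_gt0.
have nR : 0 < n%:R :> R by rewrite ltr0n.
pose l k : R := g a + D / n%:R * k%:R.
have Dn0 : 0 < D / n%:R by rewrite divr_gt0.
have /choice[p pP] : forall k, exists p : R * R, (k < n)%N ->
    [/\ a <= p.1, p.1 < p.2, p.2 <= b, g p.1 = l k /\ g p.2 = l k.+1 &
    forall r, p.1 < r < p.2 -> l k < g r < l k.+1].
  move=> k; have [kn|] := ltnP k n; last by exists (0, 0).
  have [|||s [t H]] := crossing_interval (u := l k) (v := l k.+1) gc ab.
  - by rewrite lerDl mulr_ge0// ltW.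
  - by rewrite ltrD2l ltr_pM2l// ltr_nat.
  - rewrite -lerBrDl -/D mulrAC -mulrA ler_piMr//; first exact: ltW.
    by rewrite ler_pdivrMr// mul1r ler_nat.
  by exists (s, t).
pose F k : set (measurableTypeR R) := if (k < n)%N then `](p k).1, (p k).2[%classic else set0.
have mF k : measurable (F k) by rewrite /F; case: ifP.
(* Inside the k-th crossing interval the values of g lie strictly between [l k] and [l k.+1], so
   distinct crossing intervals cannot overlap. *)
have tF : trivIset setT F.
  suff th i j : (i < j)%N -> F i `&` F j = set0.
    apply/trivIsetP => i j _ _; rewrite neq_ltn => /orP[/th//|/th].
    by rewrite setIC.
  move=> ij.
  rewrite /F; case: ifP => jn; last by rewrite ?setI0 ?set0I.
  case: ifP => kn; last by rewrite setI0.
  apply/seteqP; split => // r /= [ri rj].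
  rewrite !in_itv /= in ri rj.
  have [_ _ _ _ /(_ _ ri)/andP[_ h1]] := pP _ jn.
  have [_ _ _ _ /(_ _ rj)/andP[h2 _]] := pP _ kn.
  have : l j < l i.+1 by exact: (lt_trans h2 h1).
  by rewrite ltrD2l ltr_pM2l// ltr_nat ltnS leqNgt ij.
pose hit k j := `[< hits T (p k).1 (p k).2 j >].
have cnt (c : R) j : 0 <= c -> \sum_(k < n) (if hit k j then c else 0) <= c * 2.
  move=> c0; have [[s Ts]|NT] := pselect (T j !=set0); last first.
    rewrite big1 ?mulr_ge0// => k _; rewrite /hit; case: asboolP => // -[s [Ts _]].
    by exfalso; apply: NT; exists s.
  pose x := (g s - g a) / (D / n%:R).
  have hx (k : 'I_n) : hit k j -> k%:R <= x <= k.+1%:R.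
    move=> /asboolP[t [Tt /=]]; rewrite in_itv /= => /andP[st tt].
    rewrite ler_pdivlMr// ler_pdivrMr// (gT Ts Tt) mulrC lerBrDl lerBlDl [k.+1%:R * _]mulrC.
    have [_ _ _ [gp1 gp2] pr] := pP k (ltn_ord k).
    rewrite -/(l k) -/(l k.+1).
    have ll : l k <= l k.+1 by rewrite lerD2l ler_pM2l// ler_nat.
    move: st; rewrite le_eqVlt => /predU1P[<-|st]; first by rewrite gp1 lexx.
    move: tt; rewrite le_eqVlt => /predU1P[->|tt]; first by rewrite gp2 lexx ll.
    by have /andP[/ltW -> /ltW ->] := pr t (introT andP (conj st tt)).
  apply: (@le_trans _ _ (\sum_(k < n) c * (k%:R <= x <= k.+1%:R)%R%:R)).
    by apply: ler_sum => k _; case: ifP => [/hx ->|_]; rewrite ?mulr1 ?mulr_ge0.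
  rewrite -mulr_sumr ler_wpM2l// -natr_sum ler_nat; exact: count_unit_intervals.
(* A crossing interval that meets one of the first N sets is given up: its whole increment D / n is
   charged to such a set, which happens at most 2 N times. On the others the hypothesis [gnu]
   applies and only indices j >= N contribute. *)
have key k : (k < n)%N -> ((D / n%:R)%:E <= (\sum_(j < N) (if hit k j then D / n%:R else 0))%:E +
    (nu (F k) + \sum_(N <= j <oo) (if hit k j then d j else 0)%:E))%E.
  move=> kn; have e0 j : (0 <= (if hit k j then d j else 0)%:E)%E.
    by rewrite lee_fin; case: ifP.
  have R0 : (0 <= nu (F k) + \sum_(N <= j <oo) (if hit k j then d j else 0)%:E)%E.
    by rewrite adde_ge0// nneseries_ge0.
  have [[j jN hj]|Nh] := pselect (exists2 j, (j < N)%N & hit k j).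
    apply: (@le_trans _ _ (\sum_(j < N) (if hit k j then D / n%:R else 0))%:E); last exact: leeDl.
    rewrite lee_fin (bigD1 (Ordinal jN))//= hj lerDl.
    by apply: sumr_ge0 => i _; case: ifP => // _; exact: ltW.
  rewrite big1 ?add0e; last first.
    by move=> j _; case: ifP => // hj; exfalso; apply: Nh; exists j.
  have [ap pp pb [gp1 gp2] pr] := pP k kn.
  have := gnu ap (ltW pp) pb; rewrite hits_sumE//.
  rewrite (_ : `|_| = D / n%:R); last first.
    rewrite gp1 gp2 distrC /l opprD addrACA subrr add0r -mulrBr -natrB//.
    by rewrite subSnn mulr1 gtr0_norm.
  move=> /le_trans; apply; rewrite /F kn leeD2l//.
  rewrite (@nneseries_split _ _ 0 N); last by move=> j _; exact: e0.
  rewrite big1_seq ?add0e// => j; rewrite mem_index_iota => /andP[_ /andP[_ jN]].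
  by case: ifP => // hj; exfalso; apply: Nh; exists j.
have -> : D%:E = (\sum_(k < n) (D / n%:R)%:E)%E.
  rewrite sumEFin; congr EFin.
  by rewrite sumr_const card_ord -[RHS]mulr_natr divfK// lt0r_neq0.
apply: (le_trans (lee_sum _ (fun (k : 'I_n) _ => key k (ltn_ord k)))).
rewrite big_split /= big_split /= addeA; apply: leeD; first apply: leeD.
- rewrite sumEFin lee_fin exchange_big /=.
  apply: le_trans (ler_sum _ (fun (j : 'I_N) _ => cnt _ j (ltW Dn0))) _.
  by rewrite sumr_const card_ord.
- rewrite -measure_bigsetU//; apply: le_measure; rewrite ?inE//.
    by apply: bigsetU_measurable => k _; exact: mF.
  rewrite -bigcup_mkord => r [k /= kn]; rewrite /F kn /= !in_itv /= => /andP[pr rp].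
  have [ap _ pb _ _] := pP k kn.
  by rewrite (le_lt_trans ap pr) (lt_le_trans rp pb).
- rewrite -nneseries_sum; last by move=> *; rewrite lee_fin; case: ifP.
  rewrite -nneseriesZl; last by move=> j _; rewrite lee_fin.
  apply: lee_nneseries => [j _ _|j _].
    by apply: sume_ge0 => k _; rewrite lee_fin; case: ifP.
  by rewrite sumEFin -EFinM lee_fin [2 * _]mulrC cnt.
Qed.

Lemma level_bound_lt : g a < g b -> ((g b - g a)%:E <= nu `]a, b[%classic)%E.
Proof.
move=> gab; apply/lee_addgt0Pr => e e0.
have e4 : (0 < (e / 4)%:E)%E by rewrite lte_fin divr_gt0.
have [N _ /(_ N (leqnn N)) /= SN] :=
  nneseries_tail_cvg dfin (fun j _ => d0 j) (open_ereal_lt' e4).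
have D0 : 0 < g b - g a by rewrite subr_gt0.
(* Since n exceeds 4 N (g b - g a) / e, the increments given up add to at most e / 2; the tail,
   below e / 4 but counted twice, gives the other half. *)
pose n := (Num.truncn ((g b - g a) * N%:R * 4 / e)).+1.
have := level_bound_approx N gab (isT : (0 < n)%N).
move=> /le_trans; apply; rewrite addeAC [leRHS]addeC; apply: leeD => //.
have -> : e = e / 2 + 2 * (e / 4) by field.
rewrite (EFinD (e / 2)) (EFinM 2); apply: leeD; last by rewrite lee_pmul2l// ltW.
rewrite lee_fin -mulr_natr; have : (g b - g a) * N%:R * 4 / e <= n%:R.
  by rewrite ltW// truncnS_gt.
have nR : 0 < n%:R :> R by rewrite ltr0n.
rewrite ler_pdivrMr// => h.
rewrite mulrAC -mulrA mulrAC ler_pdivrMr//; lra.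
Qed.

End level_sets.

Lemma level_bound {R : realType} (g : R -> R)
    (nu : {measure set (measurableTypeR R) -> \bar R})
    (T : nat -> set R) (d : nat -> R) (a b : R) :
  continuous g -> (forall j, 0 <= d j) -> (\sum_(j <oo) (d j)%:E < +oo)%E ->
  (forall j s t, T j s -> T j t -> g s = g t) ->
  (forall x y, a <= x -> x <= y -> y <= b ->
    (`|g x - g y|%:E <= nu `]x, y[%classic + \esum_(j in hits T x y) (d j)%:E)%E) ->
  a <= b -> (`|g a - g b|%:E <= nu `]a, b[%classic)%E.
Proof.
move=> gc d0 dfin gT gnu ab; have [gab|gba|->] := ltgtP (g a) (g b).
- rewrite distrC gtr0_norm ?subr_gt0//.
  exact: (level_bound_lt gc d0 dfin gT gnu).
- rewrite gtr0_norm ?subr_gt0// -(opprK (g a)) addrC.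
  apply: (@level_bound_lt _ (fun x => - g x) _ T d) => //.
  + by move=> x; apply: cvgN; exact: gc.
  + by move=> j s t Ts Tt; rewrite (gT j s t).
  + by move=> x y ax xy yb; rewrite -opprB normrN opprK addrC; exact: gnu.
  + by rewrite ltrN2.
- by rewrite subrr normr0.
Qed.

(** * Measures of images of closed sets *)

Section image_measure.
Context {R : realType}.
Local Notation leb := (@lebesgue_measure R).
Local Notation realM := (measurableTypeR R).

Lemma image_measure_le (f : R -> R) (U : set R) (a b : R) (C : set R)
    (nu : {measure set realM -> \bar R}) :
  a <= b -> (nu `[a, b]%classic < +oo)%E ->
  (forall x y, a <= x -> x <= y -> y <= b ->
     (leb (f @` `[x, y] `\` U) <= nu `]x, y[%classic)%E) ->
  closed C ->
  (leb (f @` (C `&` `[a, b]) `\` U) <= nu (C `&` `[a, b]))%E.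
Proof.
move=> ab nufin H cC.
pose F n : set realM := (\bigcup_(c in C) ball c n.+1%:R^-1) `&` `[a, b].
have oF n : open (\bigcup_(c in C) ball c (n.+1%:R^-1 : R)).
  apply: bigcup_open => c _; exact: ball_open.
have mF n : measurable (F n).
  by apply: measurableI => //; exact: open_measurable.
have capF : \bigcap_n F n = C `&` `[a, b].
  apply/seteqP; split=> [t Ft|t [Ct tab] n _]; last first.
    by split => //; exists t => //; apply: ballxx; rewrite invr_gt0.
  split; last by have [] := Ft 0%N I.
  rewrite (closure_id C).1// => B /nbhs_ballP[e /= e0 eB].
  have [n] := ltr_add_invr e0; rewrite add0r => ne.
  have [[c Cc ct] _] := Ft n I; exists c; split => //; apply: eB.
  by apply: ball_sym; apply: le_ball ct; exact: ltW.
have mC : measurable (C `&` `[a, b] : set realM).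
  by apply: measurableI => //; exact: closed_measurable.
have nuF : (nu \o F) n @[n --> \oo] --> nu (\bigcap_n F n).
  apply: nonincreasing_cvg_mu => //; last 1 first.
  - apply/nonincreasing_seqP => n; apply/subsetPset => t [[c Cc ct] tab].
    split => //; exists c => //; apply: le_ball ct.
    by rewrite lef_pV2 ?posrE// ler_nat.
  - apply: le_lt_trans nufin; apply: le_measure; rewrite ?inE//.
    exact: subIsetr.
  - by rewrite capF.
rewrite -capF; apply: (cvge_ge _ nuF); apply: nearW => n /=; rewrite capF.
pose N := (Num.truncn ((b - a) * n.+1%:R)).+1.
have N0 : 0 < N%:R :> R by rewrite ltr0n.
have bN : (b - a) / N%:R < n.+1%:R^-1.
  rewrite ltr_pdivrMr// mulrC ltr_pdivlMr//.
  exact: truncnS_gt.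
pose t k : R := a + (b - a) / N%:R * k%:R.
have w0 : 0 <= (b - a) / N%:R by rewrite divr_ge0 ?subr_ge0.
have t_homo i j : (i <= j)%N -> t i <= t j.
  by move=> ij; rewrite lerD2l ler_wpM2l// ler_nat.
have t0 : t 0%N = a by rewrite /t mulr0 addr0.
have tN : t N = b by rewrite /t divfK ?lt0r_neq0// addrC subrK.
have tS k : t k.+1 = t k + (b - a) / N%:R by rewrite /t -natr1; ring.
pose hit k := `[< (k < N)%N /\ C `&` `[t k, t k.+1] !=set0 >].
pose A k := if hit k then f @` `[t k, t k.+1] `\` U else set0.
(* The images are taken over closed pieces, which cover C, but the measures over open ones, which
   are disjoint; hence the open interval in the bound on f. *)
pose B k : set realM := if hit k then `]t k, t k.+1[%classic else set0.
have mB k : measurable (B k) by rewrite /B; case: ifP.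
have tB : trivIset setT B.
  suff th i j : (i < j)%N -> B i `&` B j = set0.
    apply/trivIsetP => i j _ _; rewrite neq_ltn => /orP[/th//|/th].
    by rewrite setIC.
  move=> ij; rewrite /B; do 2![case: ifP => _; last by rewrite ?setI0 ?set0I].
  apply/seteqP; split => // r /= []; rewrite !in_itv /= => /andP[_ h1] /andP[h2 _].
  have := lt_trans h2 h1.
  by rewrite ltNge t_homo.
apply: (@le_trans _ _ (leb (\big[setU/set0]_(k < N) A k))).
  apply: le_outer_measure => _ [[s [Cs sab] <-] nU].
  move: (sab); rewrite /= in_itv /= => /andP[as_ sb].
  rewrite -bigcup_mkord.
  have [k [kN tks skt]] : exists k, [/\ (k < N)%N, t k <= s & s <= t k.+1].
    have : exists k, s <= t k by exists N; rewrite tN.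
    move=> /ex_minnP[[|k] sk kmin].
      by exists 0%N; split; rewrite ?t0// (le_trans sk)// t_homo.
    exists k; split => //; first by apply: kmin; rewrite tN.
    by rewrite leNgt; apply/negP => /ltW/kmin; rewrite ltnn.
  exists k => //; rewrite /A /hit asboolT; last first.
    by split => //; exists s; split => //=; rewrite in_itv /= tks.
  by split => //; exists s => //=; rewrite in_itv /= tks.
apply: le_trans (outer_measure_subadditive _ _ _) _.
apply: (@le_trans _ _ (\sum_(k < N) nu (B k))%E).
  apply: lee_sum => k _; rewrite /A /B; case: ifP => _; last by rewrite outer_measure0.
  by apply: H; rewrite -?t0 -?tN t_homo.
rewrite -measure_bigsetU//; apply: le_measure; rewrite ?inE//.
  by apply: bigsetU_measurable => k _; exact: mB.
rewrite -bigcup_mkord => r [k /= kN]; rewrite /B /hit; case: asboolP => // -[_ [c [Cc]]].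
rewrite /= !in_itv /= => /andP[tkc ckt] /andP[tkr rkt]; split; last first.
  rewrite /= in_itv /= -{1}t0 -{1}tN (le_trans _ (ltW tkr)) ?t_homo//=.
  by rewrite (le_trans (ltW rkt)) ?t_homo.
exists c => //; rewrite /ball /= ltr_distlC.
have arith (w e x y z v : R) : y = x + w -> w < e -> x <= z -> z <= y ->
    x < v -> v < y -> z - e < v < z + e by lra.
exact: (arith _ _ _ _ _ _ (tS k) bN).
Qed.

End image_measure.

Section avoiding_image.
Context {R : realType}.
Local Notation leb := (@lebesgue_measure R).
Local Notation realM := (measurableTypeR R).

Lemma lebesgue_bigcup_eq0 (I : countType) (F : I -> set R) :
  (forall i, leb (F i) = 0%E) -> leb (\bigcup_i F i) = 0%E.
Proof.
move=> F0; pose A n := if unpickle n is Some i then F i else set0 : set R.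
apply/eqP; rewrite -measure_le0.
apply: (@le_trans _ _ (leb (\bigcup_n A n))).
  apply: le_outer_measure => x [i _ Fx]; exists (pickle i) => //.
  by rewrite /A pickleK.
apply: le_trans (outer_measure_sigma_subadditive _ _) _.
rewrite eseries0// => n _ _; rewrite /A; case: unpickle => [i|]; last exact: outer_measure0.
exact: F0.
Qed.

Variables (f : R -> R) (nu : {measure set realM -> \bar R}).
Variables (d : nat -> R).
Hypotheses (fc : continuous f) (d0 : forall j, 0 <= d j).
Hypothesis dfin : (\sum_(j <oo) (d j)%:E < +oo)%E.

(* Collapsing the intervals [J j] turns f into a function that is constant on
   each [T j]. *)
Lemma collapsed_image_le (T J : nat -> set R) (a b : R) :
  (forall j, is_interval (J j)) -> (forall j t, T j t -> J j (f t)) ->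
  (forall x y, a <= x -> x <= y -> y <= b ->
    (`|f x - f y|%:E <= nu `]x, y[%classic + \esum_(j in hits T x y) (d j)%:E)%E) ->
  a <= b -> (leb (f @` `[a, b] `\` \bigcup_j J j) <= nu `]a, b[%classic)%E.
Proof.
move=> Ji TJ fnu ab; set U := \bigcup_j J j.
have fw : {within `[a, b], continuous f} by exact: continuous_subspaceT.
have [u uab fu] := EVT_min ab fw; have [v vab fv] := EVT_max ab fw.
have fin (m s : R) : leb (`[m, s] `\` U) \is a fin_num.
  rewrite ge0_fin_numE//; apply: (@le_lt_trans _ _ (leb `[m, s])).
    by apply: le_outer_measure; exact: subDsetl.
  by rewrite lebesgue_measure_itv; case: ifP; rewrite // -EFinB ltry.
(* The collapsing map: the length outside U, counted from the minimum of f. It is 1-Lipschitz, and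
   constant on each [J j] because the part of an interval between two of its points lies in U. Its
   value at the maximum of f bounds the measure sought. *)
pose G s := fine (leb (`[f u, s] `\` U)).
have G_homo r s : r <= s -> G r <= G s.
  move=> rs; apply: fine_le => //; apply: le_outer_measure => x [+ nU].
  by rewrite /= !in_itv /= => /andP[-> /le_trans ->].
have G_add r s : r <= s -> ((G s)%:E <= (G r)%:E + leb (`]r, s] `\` U))%E.
  move=> rs; rewrite !fineK//; apply: le_trans (outer_measureU2 _ _ _).
  apply: le_outer_measure => x [+ nU]; rewrite /= !in_itv /= => /andP[mx xs].
  by have [xr|rx] := leP x r; [left|right]; split => //=; rewrite ?in_itv /= ?mx ?xr ?rx ?xs.
have G_lip r s : `|G r - G s| <= `|r - s|.
  wlog rs : r s / r <= s => [th|].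
    have [/th//|/ltW/th] := leP r s.
    by rewrite distrC [leRHS]distrC.
  rewrite ler0_norm ?subr_le0 ?G_homo// opprB ler0_norm ?subr_le0// opprB.
  rewrite lerBlDl -lee_fin EFinD (le_trans (G_add _ _ rs))// leeD2l//.
  apply: (@le_trans _ _ (leb `]r, s])).
    by apply: le_outer_measure; exact: subDsetl.
  rewrite lebesgue_measure_itv /=; case: ifP => _; rewrite ?EFinB//.
  by rewrite lee_fin subr_ge0.
have GJ j r s : J j r -> J j s -> G r = G s.
  wlog rs : r s / r <= s => [th|].
    have [/th//|/ltW/th h Jr Js] := leP r s.
    by rewrite h.
  move=> Jr Js; apply/eqP; rewrite eq_le G_homo//= -lee_fin.
  rewrite (le_trans (G_add _ _ rs))// (_ : `]r, s] `\` U = set0) ?measure0 ?adde0//.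
  apply/seteqP; split => // x [] /=; rewrite in_itv /= => /andP[/ltW rx xs]; case.
  by exists j => //; apply: (Ji j r s) => //; rewrite rx.
have g_le x y : `|G (f x) - G (f y)| <= `|f x - f y| by exact: G_lip.
have gc : continuous (G \o f).
  move=> x; apply/cvgrPdist_le => e e0.
  have /cvgrPdist_le/(_ e e0) := @fc x.
  by apply: filterS => y; apply: le_trans; exact: g_le.
have bound x y : a <= x -> x <= y -> y <= b ->
    (`|(G \o f) x - (G \o f) y|%:E <= nu `]x, y[%classic)%E.
  move=> ax xy yb; apply: (@level_bound _ _ nu T d) => //.
    by move=> j s t /TJ Js /TJ Jt; exact: GJ Js Jt.
  move=> x' y' ax' xy' yb'.
  apply: (le_trans _ (fnu _ _ (le_trans ax ax') xy' (le_trans yb' yb))).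
  by rewrite lee_fin; exact: g_le.
have Gu : G (f u) = 0.
  apply/eqP; rewrite fine_eq0// -measure_le0.
  rewrite (@le_trans _ _ (leb `[f u, f u]))//.
    by apply: le_outer_measure; exact: subDsetl.
  by rewrite lebesgue_measure_itv /= ltxx.
apply: (@le_trans _ _ (G (f v))%:E).
  rewrite fineK//; apply: le_outer_measure => _ [[x xab <-] nU].
  by split => //=; rewrite in_itv /= fu// fv.
rewrite !in_itv /= in uab vab; move/andP: uab => [au ub]; move/andP: vab => [av vb].
have G0 : 0 <= G (f v) by rewrite fine_ge0.
have [uv|/ltW vu] := leP u v.
  have := bound _ _ au uv vb; rewrite /= Gu sub0r normrN ger0_norm// => /le_trans; apply.
  apply: le_measure; rewrite ?inE// => x /=; rewrite !in_itv /= => /andP[ux xv].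
  by rewrite (le_lt_trans au ux) (lt_le_trans xv vb).
have := bound _ _ av vu ub; rewrite /= Gu subr0 ger0_norm// => /le_trans; apply.
apply: le_measure; rewrite ?inE// => x /=; rewrite !in_itv /= => /andP[ux xv].
by rewrite (le_lt_trans av ux) (lt_le_trans xv ub).
Qed.

Lemma collapsed_closed_image_le (T J : nat -> set R) (a b : R) (C : set R) :
  (forall j, is_interval (J j)) -> (forall j t, T j t -> J j (f t)) ->
  (forall x y, a <= x -> x <= y -> y <= b ->
    (`|f x - f y|%:E <= nu `]x, y[%classic + \esum_(j in hits T x y) (d j)%:E)%E) ->
  (nu `[a, b]%classic < +oo)%E -> a <= b -> closed C ->
  (leb (f @` (C `&` `[a, b]) `\` \bigcup_j J j) <= nu (C `&` `[a, b]))%E.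
Proof.
move=> Ji TJ fnu nufin ab cC; apply: image_measure_le => // x y ax xy yb.
apply: (@collapsed_image_le T J) => // x' y' xx' xy' yy'.
by apply: fnu => //; [exact: le_trans xx'|exact: le_trans yb].
Qed.

Lemma measure_image_avoiding0 (T J : nat -> set R) (a b : R) (C : set R) :
  (forall j, is_interval (J j)) -> (forall j, (leb (J j) <= (d j)%:E)%E) ->
  (forall j, closed (T j)) -> (forall j t, T j t -> J j (f t)) ->
  (forall x y, a <= x -> x <= y -> y <= b ->
    (`|f x - f y|%:E <= nu `]x, y[%classic + \esum_(j in hits T x y) (d j)%:E)%E) ->
  (nu `[a, b]%classic < +oo)%E -> closed C ->
  (forall j, C `&` T j = set0) -> nu (C `&` `[a, b]) = 0%E ->
  leb (f @` (C `&` `[a, b])) = 0%E.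
Proof.
move=> Ji Jd cT TJ fnu nufin cC CT nuC.
(* Emptying the first M sets does not change [hits] on a segment that misses them, so the estimate
   persists there with only the later [J j] removed from the image. *)
pose TM M j := if (j < M)%N then set0 else T j.
pose JM M j := if (j < M)%N then set0 else J j.
have step M : leb (f @` (C `&` `[a, b]) `\` \bigcup_j JM M j) = 0%E.
  (* Rational endpoints make the cover of C countable; [lo] and [hi] cut the segments off at a and
     b, as the inequality is known only on [a, b]. *)
  pose good (r : rat * rat) := `[< ratr r.1 <= (ratr r.2 : R) /\
    forall j, (j < M)%N -> T j `&` `[ratr r.1, ratr r.2] = set0 >].
  pose lo (r : rat * rat) := Num.max a (ratr r.1).
  pose hi (r : rat * rat) := Num.min b (ratr r.2).
  pose F r := if good r && (lo r <= hi r) then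
    f @` (C `&` `[lo r, hi r]) `\` \bigcup_j JM M j else set0.
  apply/eqP; rewrite -measure_le0 -(@lebesgue_bigcup_eq0 _ F).
    apply: le_outer_measure => _ [[c [Cc cab] <-] nU].
    have [e /= e0 eT] : exists2 e : R, 0 < e &
        ball c e `<=` ~` \bigcup_(j in `I_M) T j.
      have oT : open (~` \bigcup_(j in `I_M) T j).
        by apply: closed_openC; apply: closed_bigcup => // j _; exact: cT.
      have nT : (~` \bigcup_(j in `I_M) T j) c.
        by move=> [j _ Tc]; have : (C `&` T j) c by []; rewrite CT.
      by have /nbhs_ballP[e /= e0 eT] := open_nbhs_nbhs (conj oT nT); exists e.
    have [|p /itvP pc] := @rat_in_itvoo R (c - e) c; first by rewrite gtrBl.
    have [|q /itvP qc] := @rat_in_itvoo R c (c + e); first by rewrite ltrDl.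
    exists (p, q) => //; rewrite /F /good /lo /hi /= asboolT; last first.
      split; first by rewrite (@le_trans _ _ c)// ltW// ?pc ?qc.
      move=> j jM; apply/seteqP; split => // x [Tx].
      rewrite /= in_itv /= => /andP[px xq]; apply: (eT x); last by exists j.
      by rewrite /ball /= ltr_distlC (lt_le_trans _ px) ?pc//= (le_lt_trans xq) ?qc.
    move: (cab); rewrite /= in_itv /= => /andP[ac cb].
    have lc : Num.max a (ratr p) <= c by rewrite ge_max ac ltW// pc.
    have ch : c <= Num.min b (ratr q) by rewrite le_min cb ltW// qc.
    rewrite (le_trans lc ch); split => //; exists c => //; split => //=.
    by rewrite in_itv /= lc.
  move=> r; rewrite /F; case: ifP => [/andP[/asboolP[_ rT] lohi]|_]; last exact: outer_measure0.
  have alo : a <= lo r by rewrite le_max lexx.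
  have hib : hi r <= b by rewrite ge_min lexx.
  have loi : ratr r.1 <= lo r by rewrite le_max lexx orbT.
  have hir : hi r <= ratr r.2 by rewrite ge_min lexx orbT.
  have sub : `[lo r, hi r] `<=` `[a, b].
    move=> x /=; rewrite !in_itv /= => /andP[lx xh].
    by rewrite (le_trans alo lx) (le_trans xh hib).
  have mI s t : measurable (C `&` `[s, t] : set realM).
    by apply: measurableI => //; exact: closed_measurable.
  apply/eqP; rewrite -measure_le0 -[leRHS]nuC.
  apply: (@le_trans _ _ (nu (C `&` `[lo r, hi r]))); last first.
    by apply: le_measure; rewrite ?inE//; exact: setIS.
  apply: (@collapsed_closed_image_le (TM M) (JM M)) => //.
  - by move=> j; rewrite /JM; case: ifP => _ // x y [].
  - by move=> j t; rewrite /JM /TM; case: ifP => // _; exact: TJ.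
  - move=> x y lx xy yh.
    have -> : hits (TM M) x y = hits T x y.
      apply/seteqP; split => j; rewrite /hits /= /TM; case: ifP => //.
        by move=> _; rewrite set0I => -[].
      move=> /rT jT [z [Tz]]; rewrite /= in_itv /= => /andP[xz zy].
      exfalso; suff : (T j `&` `[ratr r.1, ratr r.2]) z by rewrite jT.
      split => //=; rewrite in_itv /= (le_trans loi (le_trans lx xz)).
      exact: le_trans zy (le_trans yh hir).
    by apply: fnu => //; [exact: le_trans lx|exact: le_trans hib].
  - by apply: le_lt_trans nufin; apply: le_measure; rewrite ?inE //; exact: sub.
apply/eqP; rewrite -measure_le0; apply/lee_addgt0Pr => e e0.
have ee0 : (0 < e%:E)%E by rewrite lte_fin.
have [M _ /(_ M (leqnn M)) /= SM] :=
  nneseries_tail_cvg dfin (fun j _ => d0 j) (open_ereal_lt' ee0).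
rewrite add0e (le_trans _ (ltW SM))//.
apply: (@le_trans _ _ (leb (f @` (C `&` `[a, b]) `\` \bigcup_j JM M j) +
    leb (\bigcup_j JM M j))%E).
  apply: le_trans (outer_measureU2 _ _ _); apply: le_outer_measure => x fx.
  by have [|] := pselect ((\bigcup_j JM M j) x); [right|left].
rewrite step add0e.
apply: (@le_trans _ _ (leb (\bigcup_(j in ~` `I_M) J j))).
  apply: le_outer_measure => x [j _]; rewrite /JM; case: ltnP => // Mj Jx.
  by exists j => //=; apply/negP; rewrite -leqNgt.
apply: le_trans (outer_measure_sigma_subadditive_tail _ _ _) _.
by apply: lee_nneseries => [j _ _|j _]; [exact: outer_measure_ge0|exact: Jd].
Qed.
End avoiding_image.

(** * Line integrals over Lipschitz curves *)

Section curve_length.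
Context {R : realType}.
Implicit Types (f : R -> sphere R) (s : seq R).

Fixpoint chord_sum f (x : R) s : R :=
  if s is y :: s' then mdist (f x) (f y) + chord_sum f y s' else 0.

Lemma chord_sumE f x s t :
  chord_sum f x s =
  \sum_(0 <= k < size s) mdist (f (nth t (x :: s) k)) (f (nth t (x :: s) k.+1)).
Proof.
elim: s x => [|y s IH] x /=; first by rewrite big_geq.
by rewrite big_nat_recl//= IH.
Qed.

Lemma chord_sum_rcons f x s z :
  chord_sum f x (rcons s z) = chord_sum f x s + mdist (f (last x s)) (f z).
Proof. by elim: s x => [|y s IH] x /=; rewrite ?add0r ?addr0// IH addrA. Qed.

Lemma length_uptoE (g : curve R) t :
  length_upto g t = ereal_sup [set (chord_sum g (curve_start g) s)%:E |
    s in itv_partition (curve_start g) t].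
Proof.
by rewrite /length_upto; congr ereal_sup; apply: eq_imagel => s _; rewrite -chord_sumE.
Qed.

Variables (g : curve R) (Lam : R).
Local Notation a := (curve_start g).
Local Notation b := (curve_end g).
Hypothesis Lam0 : 0 <= Lam.
Hypothesis gL : forall u v, a <= u -> u <= v -> v <= b ->
  mdist (g u) (g v) <= Lam * (v - u).

(** Cut the partition at t: the chord that jumps over t is split by the triangle inequality, and all
    that lies beyond t costs at most Lam times its parameter length. *)
Lemma chord_sum_split x s t t' : itv_partition x t' s -> a <= x -> x <= t -> t <= t' ->
  t' <= b -> exists2 s1, itv_partition x t s1 &
    chord_sum g x s <= chord_sum g x s1 + Lam * (t' - t).
Proof.
elim: s x t => [|y s IH] x t; rewrite /itv_partition /=.
  move=> [_ /eqP xt'] ax xt tt' _; exists [::].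
    by split => //; rewrite eq_le xt /= xt'.
  by rewrite add0r mulr_ge0// subr_ge0.
move=> [/andP[xy py] ly] ax xt tt' tb.
have yt' : y <= t' := itv_partition_le (conj py ly).
have [yt|ty] := leP y t.
  have [s1 [ps1 ls1] cs1] := IH y t (conj py ly) (le_trans ax (ltW xy)) yt tt' tb.
  exists (y :: s1); first by split => //=; rewrite xy.
  by rewrite /= -addrA lerD2l.
(* The induction hypothesis with y in place of t bounds the chords after y by Lam * (t' - y), a
   partition of the degenerate interval [y, y] being empty. *)
have [s1 [ps1 ls1] cs1] :=
  IH y y (conj py ly) (le_trans ax (ltW xy)) (lexx _) yt' tb.
have s1nil : s1 = [::] by apply: (@itv_partitionxx _ _ y); split.
rewrite s1nil /= add0r in cs1.
have xty : mdist (g x) (g y) <= mdist (g x) (g t) + Lam * (y - t).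
  rewrite (le_trans (metric_triangle _ (g t) _))// lerD2l gL//.
  - exact: le_trans ax xt.
  - exact: ltW.
  - exact: le_trans yt' tb.
have bd : mdist (g x) (g y) + chord_sum g y s <= mdist (g x) (g t) + Lam * (t' - t) by lra.
move: xt; rewrite le_eqVlt => /predU1P[xt|xt].
  exists [::]; first by rewrite xt.
  by move: bd; rewrite xt mdistxx.
by exists [:: t]; rewrite /= ?xt// addr0.
Qed.

Lemma length_upto_ge0 t : a <= t -> (0 <= length_upto g t)%E.
Proof.
move=> at_; rewrite length_uptoE.
have pos x s : (0 <= (chord_sum g x s)%:E)%E.
  by rewrite lee_fin; elim: s x => //= y s IH x; rewrite addr_ge0 ?mdist_ge0.
move: at_; rewrite le_eqVlt => /predU1P[<-|at_].
  by apply: (le_trans (pos a [::])); apply: ereal_sup_ubound; exists [::].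
apply: (le_trans (pos a [:: t])); apply: ereal_sup_ubound; exists [:: t] => //.
exact: itv_partition1.
Qed.

Lemma length_upto_lip t t' : a <= t -> t <= t' -> t' <= b ->
  (length_upto g t' <= length_upto g t + (Lam * (t' - t))%:E)%E.
Proof.
move=> at_ tt' tb; rewrite length_uptoE; apply: ub_ereal_sup => _ [s ps <-].
have [s1 ps1 h] := chord_sum_split ps (lexx _) at_ tt' tb.
apply: (@le_trans _ _ ((chord_sum g a s1)%:E + (Lam * (t' - t))%:E)%E).
  by rewrite -EFinD lee_fin.
by rewrite leeD2r// length_uptoE; apply: ereal_sup_ubound; exists s1.
Qed.

Lemma length_upto_start : length_upto g a = 0%E.
Proof.
apply/eqP; rewrite eq_le length_upto_ge0// andbT length_uptoE.
by apply: ub_ereal_sup => _ [s /itv_partitionxx -> <-].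
Qed.

Lemma length_upto_fin t : a <= t -> t <= b -> length_upto g t \is a fin_num.
Proof.
move=> at_ tb; rewrite ge0_fin_numE ?length_upto_ge0//.
apply: le_lt_trans (length_upto_lip (lexx _) at_ tb) _.
by rewrite length_upto_start add0e ltry.
Qed.

Lemma length_upto_add t t' : a <= t -> t <= t' -> t' <= b ->
  (length_upto g t + (mdist (g t) (g t'))%:E <= length_upto g t')%E.
Proof.
move=> at_; rewrite le_eqVlt => /predU1P[<-|tt'] tb.
  by rewrite mdistxx adde0.
rewrite -leeBrDr// length_uptoE; apply: ub_ereal_sup => _ [s [ps ls] <-].
rewrite leeBrDr// -EFinD length_uptoE; apply: ereal_sup_ubound.
exists (rcons s t'); last by rewrite chord_sum_rcons (eqP ls).
split; last by rewrite last_rcons.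
by rewrite rcons_path ps (eqP ls).
Qed.

End curve_length.

Section line_integral.
Context {R : realType}.
Local Notation leb := (@lebesgue_measure R).
Local Notation realM := (measurableTypeR R).

Lemma continuous_sphere_measurable (f : R -> sphere R) :
  continuous f -> measurable_fun [set: realM] f.
Proof.
move=> fc; apply: measurability => //= _ [U oU <-]; rewrite setTI.
by apply: open_measurable; have /continuousP := fc; exact.
Qed.

Variables (g : curve R) (Lam : R).
Local Notation a := (curve_start g).
Local Notation b := (curve_end g).
Hypothesis Lam0 : 0 <= Lam.
Hypothesis gL : forall u v, a <= u -> u <= v -> v <= b ->
  mdist (g u) (g v) <= Lam * (v - u).

Lemma lipschitz_rectifiable : rectifiable g.
Proof.
rewrite /rectifiable /curve_length -ge0_fin_numE.
  exact: (length_upto_fin Lam0 gL (curve_le g)).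
exact: (length_upto_ge0 (curve_le g)).
Qed.

(** Clamping to [u, v] extends the length function and the arclength parametrization to the whole
    line, so that continuity and measurability concern total functions. *)
Let cl (u v t : R) : R := Num.max u (Num.min v t).

Let cl_itv u v t : u <= v -> u <= cl u v t <= v.
Proof. by move=> uv; rewrite /cl le_max lexx /= ge_max uv ge_min lexx. Qed.

Let cl_id u v t : u <= t <= v -> cl u v t = t.
Proof. by rewrite /cl => /andP[ut tv]; rewrite min_r// max_r. Qed.

Let cl_lip u v s t : u <= v -> s <= t -> 0 <= cl u v t - cl u v s <= t - s.
Proof.
rewrite /cl => uv st.
by case: (leP v s) => ?; case: (leP v t) => ?; case: (leP u v) => ?;
  case: (leP u s) => ?; case: (leP u t) => ?; apply/andP; split; lra.
Qed.

Let len t : R := fine (length_upto g (cl a b t)).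

Let lenE t : (len t)%:E = length_upto g (cl a b t).
Proof.
have /andP[h1 h2] := cl_itv t (curve_le g).
by rewrite fineK// (length_upto_fin Lam0 gL).
Qed.

Let len_add s t : s <= t -> mdist (g (cl a b s)) (g (cl a b t)) <= len t - len s.
Proof.
move=> st; rewrite lerBrDl -lee_fin EFinD !lenE.
have /andP[h1 _] := cl_itv s (curve_le g).
have /andP[_ h2] := cl_itv t (curve_le g).
have /andP[h3 _] := cl_lip (curve_le g) st.
by apply: length_upto_add => //; rewrite -subr_ge0.
Qed.

Let len_homo s t : s <= t -> len s <= len t.
Proof. by move=> /len_add h; rewrite -subr_ge0; apply: le_trans h; exact: mdist_ge0. Qed.

Let len_lip s t : s <= t -> len t - len s <= Lam * (t - s).
Proof.
move=> st; rewrite lerBlDl -lee_fin EFinD !lenE.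
have /andP[h1 _] := cl_itv s (curve_le g).
have /andP[_ h2] := cl_itv t (curve_le g).
have /andP[h3 h4] := cl_lip (curve_le g) st.
apply: le_trans (length_upto_lip Lam0 gL h1 _ h2) _; first by rewrite -subr_ge0.
by rewrite leeD2l// lee_fin ler_wpM2l.
Qed.

Let len_cont : continuous len.
Proof.
move=> x; apply/cvgrPdist_le => e e0.
near=> y.
have xy : `|len x - len y| <= Lam * `|x - y|.
  have [xy|/ltW yx] := leP x y.
    by rewrite ler0_norm ?subr_le0 ?len_homo// opprB ler0_norm ?subr_le0// opprB len_lip.
  by rewrite ger0_norm ?subr_ge0 ?len_homo// ger0_norm ?subr_ge0// len_lip.
apply: le_trans xy _.
apply: (@le_trans _ _ ((Lam + 1) * `|x - y|)).
  by rewrite ler_wpM2r// lerDl.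
rewrite mulrC -ler_pdivlMr ?ltr_wpDl//; near: y.
have : 0 < e / (Lam + 1) by rewrite divr_gt0// ltr_wpDl.
by move=> /(cvgrPdist_le _ _).1; apply; exact: cvg_id.
Unshelve. all: by end_near. Qed.

Let len_a : len a = 0.
Proof. by rewrite /len cl_id ?lexx ?(curve_le g)// length_upto_start. Qed.

Let ell : R := len b.

Let ellE : curve_length g = ell%:E.
Proof. by rewrite /ell lenE cl_id ?lexx ?(curve_le g). Qed.

Let arc_len t : a <= t <= b -> arclength_param g (len t) = g t.
Proof.
move=> tab; rewrite /arclength_param.
case: xgetP => [u _ [/itvP uab]|/(_ t)]; last first.
  by case; split; [rewrite in_itv|rewrite lenE cl_id].
rewrite lenE cl_id// => uE.
have lenu : len u = len t by rewrite /len !cl_id ?uab// uE.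
have dist0 x y : a <= x <= b -> a <= y <= b -> x <= y -> len x = len y -> g x = g y.
  move=> xab yab /len_add; rewrite !cl_id// => + xy; rewrite xy subrr => h.
  by apply: mdist_positivity; apply/eqP; rewrite eq_le h mdist_ge0.
have [ut|/ltW tu] := leP u t; [|symmetry]; apply: dist0; rewrite ?uab//.
Qed.

Let len_surj l : 0 <= l <= ell -> exists2 t, a <= t <= b & len t = l.
Proof.
move=> l0; have lw : {within `[a, b], continuous len} by exact: continuous_subspaceT.
have [|t] := IVT (curve_le g) lw (v := l).
  by rewrite len_a min_l ?max_r//; case/andP: l0 => /le_trans; apply.
by rewrite in_itv; exists t.
Qed.

Let arc l : sphere R := arclength_param g (cl 0 ell l).

Let ell0 : 0 <= ell.
Proof. by rewrite -len_a len_homo// curve_le. Qed.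

Let arc_lip l l' : mdist (arc l) (arc l') <= `|l - l'|.
Proof.
wlog ll' : l l' / l <= l' => [th|].
  have [/th//|/ltW/th] := leP l l'.
  by rewrite metric_sym distrC.
rewrite ler0_norm ?subr_le0// opprB.
have /andP[_ h] := cl_lip ell0 ll'; apply: le_trans h; rewrite /arc.
have [s sab sl] := len_surj (cl_itv l ell0).
have [t tab tl] := len_surj (cl_itv l' ell0).
rewrite -sl -tl !arc_len//.
have [st|/ltW ts] := leP s t.
  by have := len_add st; rewrite !cl_id.
have /andP[h _] := cl_lip ell0 ll'; rewrite -sl -tl in h.
have := len_add ts; rewrite !cl_id// metric_sym => h'.
by apply: le_trans h' (le_trans _ h); rewrite -subr_ge0 in ts *; have := len_homo ts; lra.
Qed.

Let arc_meas : measurable_fun [set: realM] arc.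
Proof.
apply: continuous_sphere_measurable => l; apply/cvg_ballP => e e0.
near=> l'; rewrite ballEmdist /=; apply: le_lt_trans (arc_lip _ _) _.
near: l'; exact: (@nbhsx_ballx _ _ l e e0).
Unshelve. all: by end_near. Qed.

Let lebc : {measure set realM -> \bar R} := mscale (NngNum Lam0) leb.

Let mab : measurable (`[a, b]%classic : set realM). Proof. by []. Qed.

(* [len] is Lam-Lipschitz, so it does not expand Lebesgue measure by more than
   the factor Lam; inner regularity reduces this to compact sets. *)
Let leb_len (S : set realM) : measurable S -> S `<=` `[0, ell] ->
  (leb S <= lebc (len @^-1` S `&` `[a, b]))%E.
Proof.
move=> mS Sl; rewrite lebesgue_regularity_inner_sup//.
apply: ub_ereal_sup => _ [V [cV VS] <-].
have clV : closed (len @^-1` V).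
  apply: (@closed_comp _ _ len) => [x _|]; first exact: len_cont.
  exact: compact_closed.
have meas (W : set R) : measurable (W : set realM) -> measurable (len @^-1` W `&` `[a, b] : set realM).
  move=> mW; apply: measurableI => //; rewrite -[X in measurable X]setTI.
  by apply: (continuous_measurable_fun len_cont).
apply: (@le_trans _ _ (lebc (len @^-1` V `&` `[a, b]))); last first.
  apply: le_measure; rewrite ?inE//; [|exact: meas|by apply: setSI => x /VS].
  by apply: meas; apply: closed_measurable; exact: compact_closed.
have VE : V = len @` (len @^-1` V `&` `[a, b]) `\` set0.
  rewrite setD0; apply/seteqP; split=> [l Vl|_ [t [Vt _] <-]//].
  have := Sl _ (VS _ Vl); rewrite /= in_itv /= => /len_surj[t tab tl].
  by exists t => //; split => //=; rewrite ?tl// in_itv.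
have lebc_itv (i : interval R) : lebc [set` i] = (Lam%:E * leb [set` i])%E by [].
rewrite {1}VE; apply: image_measure_le => //; first exact: curve_le.
  by rewrite lebc_itv lebesgue_measure_itv; case: ifP; rewrite ?mule0 ?ltry// -EFinB -EFinM ltry.
move=> x y ax xy yb; rewrite lebc_itv lebesgue_measure_itv /=.
apply: (@le_trans _ _ (leb `[len x, len y])).
  apply: le_outer_measure => _ [[t /= + <-] _]; rewrite !in_itv /= => /andP[xt ty].
  by rewrite !len_homo.
rewrite lebesgue_measure_itv /= !lte_fin -!EFinB.
move: xy; rewrite le_eqVlt => /predU1P[->|xy]; first by rewrite !ltxx mule0.
rewrite xy -EFinM; case: ifP => _; last by rewrite lee_fin mulr_ge0// subr_ge0 ltW.
by rewrite lee_fin len_lip// ltW.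
Qed.

(** A change of variables by domination: by [leb_len], Lebesgue measure on [0, ell] is at most the
    image under [len] of Lam times Lebesgue measure on [a, b], and the arclength parametrization
    composed with [len] is g. *)
Lemma line_integral_lipschitz (rho : sphere R -> \bar R) : nonneg_borel rho ->
  (line_integral g rho <= Lam%:E * \int[leb]_(t in `[a, b]) rho (g t))%E.
Proof.
move=> [mrho rho0]; rewrite /line_integral ellE /=.
pose F l := rho (arc l).
have mF : measurable_fun [set: realM] F by exact: measurableT_comp.
have -> : (\int[leb]_(l in `[0%R, ell]) rho (arclength_param g l) =
           \int[leb]_(l in `[0%R, ell]) F l)%E.
  apply: eq_integral => l; rewrite inE /= in_itv /= => lell.
  by rewrite /F /arc cl_id.
have ml : measurable_fun [set: realM] (len : realM -> realM).
  exact: (continuous_measurable_fun len_cont).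
pose m0 : {measure set realM -> \bar R} := mrestr lebc mab.
pose push : {measure set realM -> \bar R} := pushforward m0 (len : realM -> realM).
pose m2 := push ml.
pose D : set realM := `[0, ell]%classic.
have mD : measurable D by exact: measurable_itv.
pose m1 : {measure set realM -> \bar R} := mrestr leb mD.
have -> : (\int[leb]_(l in D) F l = \int[m1]_(l in D) F l)%E.
  by apply: eq_measure_integral => A mA AD; rewrite /m1 /= /mrestr setIidl.
have mm S : measurable S -> (m1 S <= m2 S)%E.
  move=> mS.
  rewrite /m1 /m2 /= /m0 /mrestr /pushforward.
  apply: le_trans (leb_len _ _) _; [exact: measurableI|by []|].
  have mpre (A : set realM) : measurable A -> measurable (len @^-1` A `&` `[a, b] : set realM).
    by move=> mA; apply: measurableI => //; rewrite -[X in measurable X]setTI; exact: (ml measurableT).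
  apply: le_measure; rewrite ?inE; [| |by apply: setSI => t []];
    by apply: mpre => //; exact: measurableI.
have m12 : (\int[m1]_(l in D) F l <= \int[m2]_(l in D) F l)%E.
  by apply: ge0_le_measure_integral => // l; exact: rho0.
apply: (le_trans m12).
rewrite (ge0_integral_pushforward ml m0) //; last 2 first.
- exact: measurable_funTS.
- by move=> y _; exact: rho0.
have mpre : measurable (len @^-1` D : set realM).
  by rewrite -[X in measurable X]setTI; exact: (ml measurableT).
have mFl A : measurable_fun (A : set realM) (F \o len).
  by apply: measurable_funTS; exact: measurableT_comp.
rewrite (@ge0_negligible_integral _ _ _ m0 _ (~` `[a, b]%classic))//; last 3 first.
- exact: measurableC.
- by move=> t _; exact: rho0.
- by rewrite /= /mrestr setICl measure0.
have -> : len @^-1` D `\` ~` `[a, b] = `[a, b]%classic.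
  rewrite setDE setCK setIidr// => t /=; rewrite !in_itv /= => /andP[at_ tb].
  by rewrite /D /= in_itv /= -len_a /ell !len_homo.
rewrite (@eq_measure_integral _ _ _ _ lebc) => [|A mA AD]; last first.
  by rewrite /= /mrestr setIidl.
rewrite ge0_integral_mscale//; last by move=> t _; exact: rho0.
rewrite le_eqVlt; apply/predU1P; left; congr (_ * _)%E.
apply: eq_integral => t; rewrite inE /= in_itv /= => tab.
rewrite /F /arc [cl 0 ell _]cl_id ?arc_len//.
by case/andP: tab => at_ tb; rewrite -len_a /ell !len_homo.
Qed.

End line_integral.

(** * The planar chart of the sphere *)

Section sphere_chart.
Context {R : realType}.
Implicit Types z w : R * R.

Lemma sin_mvt (x : R) : 0 <= x -> exists2 c, 0 <= c <= x & sin x = cos c * x.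
Proof.
move=> x0; have [|c] := @MVT_segment R sin cos 0 x x0.
- by apply: continuous_subspaceT; exact: continuous_sin.
- by rewrite in_itv /= sin0 !subr0 => cx ->; exists c.
Qed.

Lemma one_minus_cosE (t : R) : 1 - cos t = 2 * sin (t / 2) ^+ 2.
Proof.
rewrite {1}(_ : t = (t / 2) *+ 2); last by rewrite -mulr_natr divfK ?pnatr_eq0.
by rewrite cos_mulr2n cos2sin2 -mulr_natr; ring.
Qed.

Lemma one_minus_cos_le (t : R) : 0 <= t -> 1 - cos t <= t ^+ 2 / 2.
Proof.
move=> t0; rewrite one_minus_cosE.
have [|c cP ->] := @sin_mvt (t / 2); first by rewrite divr_ge0.
have : cos c ^+ 2 <= 1 by rewrite cos2sin2 gerBl sqr_ge0.
have := sqr_ge0 t; rewrite exprMn => h1 h2.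
have : cos c ^+ 2 * t ^+ 2 <= 1 * t ^+ 2 by exact: ler_wpM2r.
by rewrite expr_div_n => h; lra.
Qed.

(** The constant 16 comes from t > pi / 2, where 1 - cos t >= 1 and t <= pi < 4. For smaller t, sin
    (t / 2) = cos c * (t / 2) with c <= pi / 4, and cos c ^+ 2 >= 1 / 4 gives even t ^+ 2 / 8. *)
Lemma one_minus_cos_ge (t : R) : 0 <= t -> t <= pi -> t ^+ 2 / 16 <= 1 - cos t.
Proof.
move=> t0 tpi; have p2 := @pihalf_lt2 R.
have p1 := @pi_gt0 R.
have [tp|pt] := leP t (pi / 2); last first.
  have : cos t <= cos (pi / 2).
    by rewrite leNgt ltr_cos -?leNgt ?(ltW pt)// in_itv /=; apply/andP; split; lra.
  rewrite cos_pihalf => ct.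
  suff : t ^+ 2 <= 4 ^+ 2 by move=> h; lra.
  by rewrite ler_pXn2r ?nnegrE//; lra.
rewrite one_minus_cosE; have [|c /andP[c0 ct] ->] := @sin_mvt (t / 2); first by rewrite divr_ge0.
have cc : cos (pi / 4) <= cos c.
  rewrite leNgt ltr_cos -?leNgt ?in_itv /=; [lra|apply/andP; split; lra..].
have : cos (pi / 4 *+ 2) = 0 :> R.
  by rewrite (_ : _ *+ 2 = pi / 2) ?cos_pihalf// -mulr_natr; field.
rewrite cos_mulr2n => /eqP; rewrite subr_eq0 -mulr_natr => /eqP c4.
have p0 : 0 <= cos (pi / 4) :> R.
  by apply: cos_ge0_pihalf; apply/andP; split; lra.
have : (1 / 2) ^+ 2 <= cos c ^+ 2.
  rewrite (@le_trans _ _ (cos (pi / 4) ^+ 2))//; first by lra.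
  by rewrite ler_pXn2r ?nnegrE// (le_trans p0).
move=> h2; have h1 := sqr_ge0 t.
have h : (1 / 2) ^+ 2 * t ^+ 2 <= cos c ^+ 2 * t ^+ 2 by exact: ler_wpM2r.
by rewrite (_ : (cos c * (t / 2)) ^+ 2 = cos c ^+ 2 * t ^+ 2 / 4); [lra|field].
Qed.

Definition sqdist z w : R := (z.1 - w.1) ^+ 2 + (z.2 - w.2) ^+ 2.
Definition den z : R := 1 + z.1 ^+ 2 + z.2 ^+ 2.

Lemma den_ge1 z : 1 <= den z.
Proof. by have := sqr_ge0 z.1; have := sqr_ge0 z.2; rewrite /den; lra. Qed.

Lemma cos_mdist (x y : sphere R) : cos (mdist x y) = dot3 (stereo x) (stereo y).
Proof. by rewrite -[mdist x y]/(sdist x y) /sdist acosK// in_itv /= dot3_itv// stereo_unit. Qed.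

(** Both sides are half the squared chord between the two points of the unit sphere. *)
Lemma one_minus_cos_mdist z w :
  1 - cos (mdist (Some z : sphere R) (Some w)) = 2 * sqdist z w / (den z * den w).
Proof.
rewrite cos_mdist; case: z w => [a b] [c d]; rewrite /dot3 /stereo /den /sqdist /=.
have n1 := lt0r_neq0 (stereo_den_gt0 a b).
have n2 := lt0r_neq0 (stereo_den_gt0 c d).
by field; rewrite n1 n2.
Qed.

Lemma mdist_itv (x y : sphere R) : 0 <= mdist x y <= pi.
Proof.
rewrite -[mdist x y]/(sdist x y) /sdist; have h := dot3_itv (stereo_unit x) (stereo_unit y).
by rewrite acos_ge0// acos_lepi.
Qed.

Lemma mdist_sq_le z w : mdist (Some z : sphere R) (Some w) ^+ 2 <= 32 * sqdist z w.
Proof.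
have /andP[m0 mpi] := mdist_itv (Some z) (Some w).
have := one_minus_cos_ge m0 mpi; rewrite one_minus_cos_mdist.
have s0 : 0 <= sqdist z w by rewrite addr_ge0 ?sqr_ge0.
have d1 : 1 <= den z * den w by rewrite mulr_ege1 ?den_ge1.
have : 2 * sqdist z w / (den z * den w) <= 2 * sqdist z w.
  by rewrite ler_pdivrMr ?(lt_le_trans ltr01)// ler_peMr// mulr_ge0.
by move=> h1 h2; lra.
Qed.

Lemma sqdist_le z w :
  4 * sqdist z w <= den z * den w * mdist (Some z : sphere R) (Some w) ^+ 2.
Proof.
have /andP[m0 _] := mdist_itv (Some z) (Some w).
have := one_minus_cos_le m0; rewrite one_minus_cos_mdist.
have d0 : 0 < den z * den w by rewrite mulr_gt0// (lt_le_trans ltr01)// den_ge1.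
by rewrite ler_pdivrMr// => h; lra.
Qed.

(** The factor 6 is a convenient upper bound for the square root of the 32 in [mdist_sq_le]. It
    becomes the Lipschitz constant of horizontal and vertical segments. *)
Lemma mdist_le_coord (M : R) z w : sqdist z w <= M ^+ 2 -> 0 <= M ->
  mdist (Some z : sphere R) (Some w) <= 6 * M.
Proof.
move=> h M0; have /andP[m0 _] := mdist_itv (Some z) (Some w).
rewrite -(@ler_pXn2r _ 2%N)// ?nnegrE ?mulr_ge0//.
by apply: le_trans (mdist_sq_le z w) _; have := sqr_ge0 M; rewrite exprMn; lra.
Qed.

Lemma den_le (M : R) z : `|z.1| <= M -> `|z.2| <= M -> den z <= 1 + 2 * M ^+ 2.
Proof.
move=> z1 z2; have h (x : R) : `|x| <= M -> x ^+ 2 <= M ^+ 2.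
  move=> xM; rewrite -(real_normK (num_real x)) ler_pXn2r ?nnegrE//.
  exact: le_trans xM.
by have := h _ z1; have := h _ z2; rewrite /den; lra.
Qed.

Lemma coord_le_mdist (M : R) z w :
  `|z.1| <= M -> `|z.2| <= M -> `|w.1| <= M -> `|w.2| <= M ->
  `|z.1 - w.1| <= (1 + 2 * M ^+ 2) * mdist (Some z : sphere R) (Some w) /\
  `|z.2 - w.2| <= (1 + 2 * M ^+ 2) * mdist (Some z : sphere R) (Some w).
Proof.
move=> z1 z2 w1 w2; have /andP[m0 _] := mdist_itv (Some z) (Some w).
set m := mdist _ _ in m0 *; set B := 1 + 2 * M ^+ 2.
have B0 : 0 <= B by have := sqr_ge0 M; rewrite /B; lra.
have s : sqdist z w <= (B * m) ^+ 2.
  have := sqdist_le z w; rewrite -/m => h.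
  have : den z * den w * m ^+ 2 <= B ^+ 2 * m ^+ 2.
    rewrite ler_wpM2r ?sqr_ge0// expr2.
    by apply: ler_pM; rewrite ?den_le ?(le_trans ler01 (den_ge1 _)).
  by rewrite -exprMn => h'; have := sqr_ge0 (B * m); lra.
have root (x : R) : x ^+ 2 <= (B * m) ^+ 2 -> `|x| <= B * m.
  by rewrite -(real_normK (num_real x)) ler_pXn2r ?nnegrE ?mulr_ge0.
have := sqr_ge0 (z.1 - w.1); have := sqr_ge0 (z.2 - w.2).
by split; apply: root; move: s; rewrite /sqdist; lra.
Qed.

Lemma Some_open (U : set (R * R)) : open U -> open (Some @` U : set (sphere R)).
Proof.
move=> oU; rewrite openE => _ [z Uz <-].
have /nbhs_ballP[e /= e0 eU] := open_nbhs_nbhs (conj oU Uz).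
(* [k * den z] is the value at s = e ^+ 2 of the increasing function s / (1 + 2 * den z + 2 * s),
   whose denominator bounds [den w] when [sqdist z w] is s. A point w with [sqdist z w >= e ^+ 2]
   therefore has 1 - cos of its distance to z above k / 2, and so has the point at infinity. *)
pose k := e ^+ 2 / (den z * (1 + 2 * den z + 2 * e ^+ 2)).
have dz := den_ge1 z.
have e2 : 0 < e ^+ 2 by rewrite exprn_gt0.
have D0 : 0 < den z * (1 + 2 * den z + 2 * e ^+ 2) by rewrite mulr_gt0//; lra.
have k0 : 0 < k by rewrite divr_gt0.
pose r := Num.min 1 k.
have r0 : 0 < r by rewrite lt_min ltr01.
have small (x : sphere R) : mdist (Some z : sphere R) x < r -> 1 - cos (mdist (Some z : sphere R) x) <= k / 2.
  move=> xr; have /andP[m0 _] := mdist_itv (Some z : sphere R) x.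
  have xr' : mdist (Some z : sphere R) x ^+ 2 <= r ^+ 2 by rewrite ler_pXn2r ?nnegrE// ltW.
  have r1 : r * r <= 1 * k by apply: ler_pM; rewrite ?(ltW r0)// ge_min lexx ?orbT.
  by have := one_minus_cos_le m0; rewrite expr2 in xr'; lra.
have kE : k * (den z * (1 + 2 * den z + 2 * e ^+ 2)) = e ^+ 2.
  by rewrite divfK// lt0r_neq0.
apply/nbhs_ballP; exists r => // -[w|]; rewrite ballEmdist /= => /small; last first.
  have -> : 1 - cos (mdist (Some z : sphere R) None) = 2 / den z.
    rewrite cos_mdist /dot3; case: z dz {Uz eU k D0 k0 r r0 small kE} => x y dz /=.
    have n1 := lt0r_neq0 (stereo_den_gt0 x y).
    by rewrite /den /=; field.
  have d0 : 0 < den z by rewrite (lt_le_trans ltr01).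
  rewrite ler_pdivrMr// => h; exfalso.
  have h0 : 0 < k * den z by rewrite mulr_gt0.
  have : 4 * (1 + 2 * den z + 2 * e ^+ 2) <= k * den z * (1 + 2 * den z + 2 * e ^+ 2).
    by apply: ler_wpM2r; lra.
  rewrite -mulrA kE; lra.
rewrite one_minus_cos_mdist => h; exists w => //; apply: eU.
have dw : den w <= 1 + 2 * den z + 2 * sqdist z w.
  rewrite /den /sqdist; have := sqr_ge0 (2 * z.1 - w.1).
  by have := sqr_ge0 (2 * z.2 - w.2); lra.
have s0 : 0 <= sqdist z w by rewrite addr_ge0 ?sqr_ge0.
have dw1 := den_ge1 w.
have d0 : 0 < den z * den w by rewrite mulr_gt0//; lra.
suff se : sqdist z w < e ^+ 2.
  have root (x : R) : x ^+ 2 < e ^+ 2 -> `|x| < e.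
    by rewrite -(real_normK (num_real x)) ltr_pXn2r// nnegrE// ltW.
  have := sqr_ge0 (z.1 - w.1); have := sqr_ge0 (z.2 - w.2) => s2 s1.
  by split; rewrite /ball /=; apply: root; move: se; rewrite /sqdist; lra.
rewrite ltNge; apply/negP => es.
move: h; rewrite ler_pdivrMr// => h.
have kd : 0 <= k / 2 * den z by rewrite mulr_ge0 ?divr_ge0 ?ltW//; lra.
have : k / 2 * den z * den w <= k / 2 * den z * (1 + 2 * den z + 2 * sqdist z w).
  exact: ler_wpM2l.
have : (e ^+ 2) * (1 + 2 * den z + 2 * sqdist z w) <= sqdist z w * (1 + 2 * den z + 2 * e ^+ 2).
  have : 0 <= (sqdist z w - e ^+ 2) * (1 + 2 * den z) by apply: mulr_ge0; lra.
  by lra.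
rewrite -kE => h1 h2.
have P0 : 0 < 1 + 2 * den z + 2 * e ^+ 2 by lra.
have h3 : k * den z * (1 + 2 * den z + 2 * sqdist z w) <= sqdist z w.
  by rewrite -(ler_pM2r P0); rewrite kE in h1; move: h1; rewrite -{1}kE; lra.
by rewrite mulrA in h; lra.
Qed.

End sphere_chart.

(** * Integrals over generic horizontal and vertical lines *)

Section lines.
Context {R : realType}.
Local Notation leb := (@lebesgue_measure R).
Local Notation realM := (measurableTypeR R).
Local Notation plane := (measurableTypeR R * measurableTypeR R)%type.

Definition axis (v : bool) (c s : R) : R * R := if v then (c, s) else (s, c).

Definition line (v : bool) (c s : R) : sphere R := Some (axis v c s).

(** The inverse of the spherical density at the corners of the square [-M, M]^2, where that density
    is smallest. *)
Definition chart_const (M : R) : R := (1 + 2 * M ^+ 2) ^+ 2 / 4.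

Lemma chart_const_gt0 M : 0 < chart_const M.
Proof. by have := sqr_ge0 M => h; rewrite divr_gt0// exprn_gt0//; lra. Qed.

Let sq (M : R) : set plane := `[- M, M]%classic `*` `[- M, M]%classic.

Let mbox M : measurable (sq M).
Proof. by apply: measurableX; exact: measurable_itv. Qed.

Let lebP : {measure set plane -> \bar R} := (lebesgue_measure \x lebesgue_measure)%E.

Lemma chart_measure_le (M : R) (S : set (sphere R)) : measurable S ->
  (lebP ((Some : plane -> sphere R) @^-1` S `&` sq M) <=
   (chart_const M)%:E * sphere_measure S)%E.
Proof.
move=> mS; set A := _ @^-1` S.
have mA : measurable (A : set plane).
  by rewrite -[X in measurable X]setTI; exact: (@Some_measurable R).
have mAs : measurable (A `&` sq M) by exact: measurableI.
have C0 := chart_const_gt0 M.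
rewrite -lee_pdivrMl//.
have dens : (\int[lebP]_(z in A `&` sq M) sphere_density z <= sphere_measure S)%E.
  apply: (@ge0_subset_integral _ _ _ lebP _ _ mAs mA).
  - by apply: measurable_funTS; exact: measurable_sphere_density.
  - by move=> z _; exact: sphere_density_ge0.
  - exact: subIsetl.
apply: le_trans dens; rewrite -(integral_cst lebP mAs); apply: ge0_le_integral => //.
- by move=> z _; rewrite lee_fin invr_ge0 ltW.
- by apply: measurable_funTS; exact: measurable_sphere_density.
move=> [x y] [_ []] /=; rewrite !in_itv /= -!ler_norml => xM yM.
have := @den_le _ M (x, y) xM yM.
have := den_ge1 (x, y); rewrite /den /= => d1 dM.
rewrite lee_fin /chart_const invf_div ler_pM2l// lef_pV2 ?posrE ?exprn_gt0 ?ler_pXn2r ?nnegrE//=; lra.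
Qed.

Lemma chart_integral_le (M : R) (f : sphere R -> \bar R) : nonneg_borel f ->
  (\int[lebP]_z ((f \o Some) \_ (sq M)) z <=
   (chart_const M)%:E * \int[@sphere_measure R]_x f x)%E.
Proof.
move=> [mf f0].
have mSome : measurable_fun [set: plane] (Some : plane -> sphere R) := @Some_measurable R.
pose m0 : {measure set plane -> \bar R} := mrestr lebP (mbox M).
pose push : {measure set (sphere R) -> \bar R} := pushforward m0 (Some : plane -> sphere R).
pose m1 := push mSome.
pose C := NngNum (ltW (chart_const_gt0 M)).
pose m2 : {measure set (sphere R) -> \bar R} := mscale C (@sphere_measure R).
have mm (S : set (sphere R)) : measurable S -> (m1 S <= m2 S)%E.
  by move=> mS; exact: chart_measure_le.
have m12 : (\int[m1]_x f x <= \int[m2]_x f x)%E by exact: ge0_le_measure_integral.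
rewrite ge0_integral_mscale// in m12; apply: le_trans m12.
have E := ge0_integral_pushforward mSome m0 measurableT mf (fun x _ => f0 x).
rewrite -[X in (_ <= X)%E]/(\int[pushforward m0 (Some : plane -> sphere R)]_x f x)%E E.
rewrite -integral_mkcond preimage_setT.
have mfS : measurable_fun [set: plane] (f \o Some) by exact: measurableT_comp.
apply: (@le_trans _ _ (\int[m0]_(z in sq M) (f \o Some) z)%E).
  rewrite (@eq_measure_integral _ _ _ _ lebP) => [//|A mA AM].
  by rewrite /m0 /= /mrestr setIidl.
apply: ge0_subset_integral => //.
by move=> z _; exact: f0.
Qed.

(** Tonelli in the chart followed by Markov's inequality in the transverse coordinate c; the two
    values of v use the two orders of integration. *)
Lemma line_markov (v : bool) (M k : R) (f : sphere R -> \bar R) :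
  0 < k -> nonneg_borel f ->
  (k%:E * leb (`[(- M)%R, M] `&`
     [set c | (k%:E <= \int[leb]_(s in `[(- M)%R, M]) f (line v c s))%E]) <=
   (chart_const M)%:E * \int[@sphere_measure R]_x f x)%E.
Proof.
move=> k0 [mf f0]; apply: le_trans (chart_integral_le M (conj mf f0)).
pose F : plane -> \bar R := (f \o Some) \_ (sq M).
have mfS : measurable_fun [set: plane] (f \o Some).
  by apply: measurableT_comp => //; exact: (@Some_measurable R).
have mF : measurable_fun [set: plane] F.
  by apply/(measurable_restrictT _ _).1 => //; apply: measurable_funTS.
have F0 z : (0 <= F z)%E by rewrite /F /patch; case: ifP => _ //; exact: f0.
pose G c := (\int[leb]_s F (axis v c s))%E.
have FG : (\int[lebP]_z F z = \int[leb]_c G c)%E.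
  by rewrite /G; case: (v); [rewrite fubini_tonelli1|rewrite fubini_tonelli2].
have mG : measurable_fun [set: realM] G.
  rewrite /G; case: (v); first exact: measurable_fun_fubini_tonelli_F.
  exact: measurable_fun_fubini_tonelli_G.
have G0 c : (0 <= G c)%E by apply: integral_ge0.
rewrite -/F FG.
have mI : measurable (`[- M, M]%classic : set realM) by exact: measurable_itv.
apply: (@le_trans _ _ (\int[leb]_(c in `[(- M)%R, M]) `|G c|)%E); last first.
  under eq_integral do rewrite gee0_abs//.
  by apply: ge0_subset_integral.
apply: le_trans (le_integral_abse leb mI (measurable_funTS mG) k0).
apply: lee_wpmul2l; first by rewrite lee_fin ltW.
apply: le_lebesgue => c [/= cM kc].
split => //=; rewrite gee0_abs//; apply: le_trans kc _.
rewrite le_eqVlt; apply/predU1P; left; rewrite integral_mkcond.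
apply: eq_integral => s _; rewrite /F /patch /line /axis.
have -> : ((if v then (c, s) else (s, c)) \in sq M) = (s \in `[- M, M]%classic).
  by apply/idP/idP; rewrite !inE; case: (v) => //= -[].
by [].
Qed.

End lines.

Section generic_lines.
Context {R : realType}.
Local Notation leb := (@lebesgue_measure R).
Local Notation realM := (measurableTypeR R).
Local Notation II n := (`[(- (n%:R : R))%R, (n%:R : R)%R]%classic).

Lemma lebesgue_sub_eq0 (A B : set R) : A `<=` B -> leb B = 0%E -> leb A = 0%E.
Proof.
move=> AB B0; apply/eqP; rewrite -measure_le0 -B0.
exact: le_lebesgue.
Qed.

(** Either x <= eta or x <= x ^+ 2 / eta. Integrated over a segment, this takes the place of the
    Cauchy-Schwarz inequality, with a weight eta left to choose. *)
Lemma le_add_sqr (x : \bar R) (eta : R) : (0 <= x)%E -> 0 < eta ->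
  (x <= eta%:E + (eta^-1)%:E * x ^+ 2)%E.
Proof.
case: x => [x||]// x0 e0; last first.
  by rewrite expe2 mulyy gt0_muley ?addey ?lte_fin ?invr_gt0// ltW.
rewrite expe2 -!EFinM -EFinD lee_fin.
have : 0 <= (x - eta) ^+ 2 by exact: sqr_ge0.
have xe : 0 <= x by rewrite -lee_fin.
rewrite -(ler_pM2r e0) => h.
have -> : (eta + eta^-1 * (x * x)) * eta = eta ^+ 2 + x ^+ 2 by field; rewrite gt_eqF.
have : 0 <= x * eta by rewrite mulr_ge0// ltW.
by lra.
Qed.

Lemma line_lip v c (s t : R) : s <= t -> mdist (line v c s) (line v c t) <= 6 * (t - s).
Proof.
move=> st; apply: mdist_le_coord; last by rewrite subr_ge0.
by rewrite /sqdist /axis; case: v; rewrite /= subrr expr0n /= ?add0r ?addr0 -sqrrN opprB.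
Qed.

Lemma line_continuous v (c : R) : continuous (line v c).
Proof.
move=> s; apply/cvg_ballP => e e0; near=> t; rewrite ballEmdist /=.
apply: (@le_lt_trans _ _ (6 * `|s - t|)).
  have [st|/ltW ts] := leP s t.
    by rewrite ler0_norm ?subr_le0// opprB line_lip.
  by rewrite metric_sym ger0_norm ?subr_ge0// line_lip.
rewrite mulrC -ltr_pdivlMr//; near: t.
by apply: (@nbhsx_ballx _ _ s (e / 6)); rewrite divr_gt0.
Unshelve. all: by end_near. Qed.

Definition segment v c (s t : R) (st : s <= t) : curve R :=
  Curve st (continuous_subspaceT (@line_continuous v c)).

Lemma measurable_line v (c : R) (f : sphere R -> \bar R) (A : set realM) :
  measurable_fun [set: sphere R] f -> measurable_fun A (f \o line v c).
Proof.
move=> mf; apply: measurable_funTS; apply: measurableT_comp => //.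
by apply: continuous_sphere_measurable; exact: line_continuous.
Qed.

Lemma segment_rectifiable v c s t (st : s <= t) : rectifiable (segment v c st).
Proof.
apply: (@lipschitz_rectifiable _ (segment v c st) 6) => // a b _ ab _.
exact: line_lip.
Qed.

Lemma segment_integral_le v c s t (st : s <= t) (f : sphere R -> \bar R) :
  nonneg_borel f ->
  (line_integral (segment v c st) f <= 6%:E * \int[leb]_(r in `[s, t]) f (line v c r))%E.
Proof.
move=> fb; apply: (@line_integral_lipschitz _ (segment v c st) 6) => // a b _ ab _.
exact: line_lip.
Qed.

Lemma nonneg_borel_sqr (f : sphere R -> \bar R) : nonneg_borel f ->
  nonneg_borel (fun x => f x ^+ 2)%E.
Proof.
move=> [mf f0]; split=> [|x]; last exact: sqre_ge0.
rewrite (_ : (fun x => _) = (f \* f)%E); first exact: emeasurable_funM.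
by apply/funext => x; rewrite expe2.
Qed.

Lemma ereal_eq0_eps (x : \bar R) : (0 <= x)%E -> (forall e, 0 < e -> (x <= e%:E)%E) ->
  x = 0%E.
Proof.
move=> x0 xe; apply/eqP; rewrite eq_le x0 andbT; apply/lee_addgt0Pr => e e0.
by rewrite add0e xe.
Qed.

Lemma exhaust_eq0 (Q : nat -> set R) :
  (forall n, leb (II n `&` Q n) = 0%E) ->
  (forall m n, (m <= n)%N -> Q m `<=` Q n) -> leb (\bigcup_n Q n) = 0%E.
Proof.
move=> Q0 Qh; apply: lebesgue_sub_eq0 (lebesgue_bigcup_eq0 Q0) => c [m _ Qc].
pose n := maxn m (Num.truncn `|c|).+1.
exists n => //; split; last by apply: Qh Qc; rewrite leq_maxl.
rewrite /= in_itv /= -ler_norml (le_trans (ltW (truncnS_gt _)))// ler_nat.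
by rewrite leq_maxr.
Qed.

Lemma le_line_integral v c (f : sphere R -> \bar R) (m n : nat) :
  nonneg_borel f -> (m <= n)%N ->
  (\int[leb]_(s in `[(- m%:R)%R, m%:R]) f (line v c s) <=
   \int[leb]_(s in `[(- n%:R)%R, n%:R]) f (line v c s))%E.
Proof.
move=> [mf f0] mn; apply: (@ge0_subset_integral _ realM) => //.
- exact: measurable_line.
- move=> s /=; rewrite !in_itv /= -!ler_norml => /le_trans; apply.
  by rewrite ler_nat.
Qed.

Lemma line_integral_finite v (f : sphere R -> \bar R) : nonneg_borel f ->
  (\int[@sphere_measure R]_x f x < +oo)%E ->
  leb [set c | exists n : nat,
    \int[leb]_(s in `[(- n%:R)%R, n%:R]) f (line v c s) = +oo]%E = 0%E.
Proof.
move=> fb ffin.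
pose Q (n : nat) : set R :=
  [set c | \int[leb]_(s in `[(- n%:R)%R, n%:R]) f (line v c s) = +oo]%E.
apply: (@lebesgue_sub_eq0 _ (\bigcup_n Q n)) => [c [n cn]|]; first by exists n.
apply: exhaust_eq0 => [n|m n mn c Qc]; last first.
  by apply/eqP; rewrite -leye_eq -Qc; exact: le_line_integral.
have I0 : (0 <= \int[@sphere_measure R]_x f x)%E.
  by apply: integral_ge0 => x _; have [_] := fb; apply.
have Ifin : (\int[@sphere_measure R]_x f x)%E \is a fin_num by rewrite ge0_fin_numE.
have C0 := @chart_const_gt0 R n%:R.
set L := fine (\int[@sphere_measure R]_x f x)%E.
have L0 : 0 <= L by rewrite fine_ge0.
apply: ereal_eq0_eps => [|e e0]; first exact: outer_measure_ge0.
(* An infinite integral exceeds every threshold, so k may be taken large enough for Markov's bound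
   to fall below e; the added 1 keeps k positive when L = 0. *)
pose k := (chart_const n%:R * L + 1) / e.
have CL0 : 0 < chart_const n%:R * L + 1 by rewrite ltr_wpDl ?mulr_ge0 ?(ltW C0).
have k0 : 0 < k by exact: divr_gt0.
have := line_markov v n%:R k0 fb.
rewrite -(fineK Ifin) -/L -EFinM => h.
have {}h : (k%:E * leb (II n `&` Q n) <= (chart_const n%:R * L)%:E)%E.
  apply: le_trans h; apply: lee_wpmul2l; first by rewrite lee_fin ltW.
  apply: le_lebesgue.
  by apply: setIS => c Qc /=; rewrite Qc leey.
rewrite -lee_pdivlMl// in h; apply: le_trans h _.
rewrite -EFinM lee_fin /k invf_div mulrAC ler_pdivrMr//.
by rewrite ler_pM2l// lerDl.
Qed.

Lemma line_integral_zero v (f : sphere R -> \bar R) : nonneg_borel f ->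
  (\int[@sphere_measure R]_x f x = 0)%E ->
  leb [set c | exists n : nat,
    (0 < \int[leb]_(s in `[(- n%:R)%R, n%:R]) f (line v c s))%E] = 0%E.
Proof.
move=> fb fint.
pose Q (n : nat) : set R :=
  [set c | (0 < \int[leb]_(s in `[(- n%:R)%R, n%:R]) f (line v c s))%E].
apply: (@lebesgue_sub_eq0 _ (\bigcup_n Q n)) => [c [n cn]|]; first by exists n.
apply: exhaust_eq0 => [n|m n mn c Qc]; last first.
  exact: lt_le_trans Qc (le_line_integral _ _ fb mn).
pose B (m : nat) : set R := II n `&` [set c |
  (m.+1%:R^-1%:E <= \int[leb]_(s in `[(- n%:R)%R, n%:R]) f (line v c s))%E].
apply: (@lebesgue_sub_eq0 _ (\bigcup_m B m)) => [c [cn Qc]|].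
  have [m mc] : exists m : nat, (m.+1%:R^-1%:E <=
      \int[leb]_(s in `[(- n%:R)%R, n%:R]) f (line v c s))%E.
    move: Qc; rewrite /Q /=; case: (integral _ _ _) => [r| |//].
      rewrite lte_fin => /ltr_add_invr[m]; rewrite add0r => /ltW ?.
      by exists m; rewrite lee_fin.
    by exists 0%N; rewrite leey.
  by exists m.
apply: lebesgue_bigcup_eq0 => m.
have k0 : 0 < m.+1%:R^-1 :> R by rewrite invr_gt0.
have := line_markov v n%:R k0 fb; rewrite fint mule0 => h.
apply/eqP; rewrite -measure_le0.
by move: h; rewrite pmule_rle0// lte_fin.
Qed.

(** On a line that contains a curve of Gamma, an admissible rho has an integral of at least 1 / 6 in
    the Euclidean parameter, which bounds the integral of its square from below by a constant.
    Markov's inequality and admissible functions of small norm then give measure zero. *)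
Lemma modulus0_lines v (Gamma : set (curve R)) : modulus2 Gamma = 0%E ->
  leb [set c | exists s t (st : s <= t), Gamma (segment v c st)] = 0%E.
Proof.
move=> G0.
pose Q (n : nat) : set R := [set c | exists s t (st : s <= t),
  [/\ - n%:R <= s, t <= n%:R & Gamma (segment v c st)]].
apply: (@lebesgue_sub_eq0 _ (\bigcup_n Q n)) => [c [s [t [st Gc]]]|].
  pose n := (Num.truncn (`|s| + `|t|)).+1.
  have sn : `|s| + `|t| <= n%:R by rewrite ltW// truncnS_gt.
  exists n => //; exists s, t, st; split => //.
    by rewrite lerNl (le_trans (ler_norm _))// normrN (le_trans _ sn)// lerDl.
  by rewrite (le_trans (ler_norm _))// (le_trans _ sn)// lerDr.
apply: exhaust_eq0 => [n|m n mn c [s [t [st [ms tm Gc]]]]]; last first.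
  have mnR : m%:R <= n%:R :> R by rewrite ler_nat.
  by exists s, t, st; split => //; lra.
pose M : R := n.+1%:R.
have M0 : 0 < M by rewrite ltr0n.
(* With this eta, the constant term in [le_add_sqr] integrates to 2 * M * eta = 1 / 12 over [-M, M].
   Then 1 <= 6 * (1 / 12 + G / eta) forces G >= eta / 12, which is k. *)
pose eta : R := (24 * M)^-1.
have eta0 : 0 < eta by rewrite invr_gt0 mulr_gt0.
pose k : R := eta / 12.
have k0 : 0 < k by rewrite divr_gt0.
have C0 := @chart_const_gt0 R M.
apply: ereal_eq0_eps => [|e e0]; first exact: outer_measure_ge0.
have : (modulus2 Gamma < (k * e / chart_const M)%:E)%E.
  by rewrite G0 lte_fin divr_gt0// mulr_gt0.
move=> /ereal_inf_lt[_ [rho [rhob adm] <-] small].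
have [mrho rho0] := rhob.
have := line_markov v M k0 (nonneg_borel_sqr rhob).
set A := (X in (_ * leb X)%E) => h.
have sub : II n `&` Q n `<=` A.
  move=> c [cn [s [t [st [ns tn Gc]]]]].
  have nM : n%:R <= M by rewrite ler_nat.
  split; first by move: cn; rewrite /= !in_itv /= => /andP[? ?]; apply/andP; split; lra.
  rewrite /=; set G := (\int[leb]_(s in _) _)%E.
  have G0' : (0 <= G)%E by apply: integral_ge0 => x _; exact: sqre_ge0.
  have st_sub : `[s, t] `<=` `[- M, M].
    by move=> x /=; rewrite !in_itv /= => /andP[? ?]; apply/andP; split; lra.
  have mline A' : measurable_fun (A' : set realM) (rho \o line v c) by exact: measurable_line.
  have msq A' : measurable_fun (A' : set realM) ((fun x => rho x ^+ 2)%E \o line v c).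
    by apply: measurable_line; exact: (nonneg_borel_sqr rhob).1.
  have eta_sq0 x : (0 <= (eta^-1)%:E * rho x ^+ 2)%E.
    by apply: mule_ge0; [rewrite lee_fin invr_ge0 ltW|exact: sqre_ge0].
  have bound : (\int[leb]_(r in `[s, t]) rho (line v c r) <= (2 * M * eta)%:E + (eta^-1)%:E * G)%E.
    have mM : measurable (`[- M, M]%classic : set realM) by exact: measurable_itv.
    apply: (@le_trans _ _ (\int[leb]_(r in `[s, t]) (eta%:E + (eta^-1)%:E * rho (line v c r) ^+ 2))%E).
      apply: ge0_le_integral => //.
      - apply: emeasurable_funD; first exact: measurable_cst.
        by apply: measurable_funeM; exact: msq.
      - by move=> x _; exact: le_add_sqr.
    apply: (@le_trans _ _ (\int[leb]_(r in `[(- M)%R, M]) (eta%:E + (eta^-1)%:E * rho (line v c r) ^+ 2))%E).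
      apply: (@ge0_subset_integral _ realM) => //.
        apply: emeasurable_funD; first exact: measurable_cst.
        by apply: measurable_funeM; exact: msq.
      by move=> x _; apply: adde_ge0 => //; rewrite lee_fin ltW.
    have ->: (\int[leb]_(r in `[(- M)%R, M]) (eta%:E + (eta^-1)%:E * rho (line v c r) ^+ 2) =
        \int[leb]_(r in `[(- M)%R, M]) eta%:E + (eta^-1)%:E * G)%E.
      rewrite ge0_integralD//; last 2 first.
      - by move=> x _; rewrite lee_fin ltW.
      - by apply: measurable_funeM; exact: msq.
      rewrite ge0_integralZl//.
        by move=> x _; exact: sqre_ge0.
      by rewrite lee_fin invr_ge0 ltW.
    rewrite integral_cst//= lebesgue_measure_itv /= lte_fin ifT; last by lra.
    by rewrite leeD2r// -EFinB -EFinM lee_fin; lra.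
  have := le_trans (adm _ Gc (segment_rectifiable v c st))
    (segment_integral_le v c st rhob).
  move=> /le_trans/(_ (lee_wpmul2l _ bound)); rewrite lee_fin => /(_ (ler0n _ 6)).
  have -> : 2 * M * eta = 12^-1 by rewrite /eta; field; rewrite gt_eqF.
  case: G G0' {bound} => [x| |//] x0; last by rewrite leey.
  rewrite -!(EFinM, EFinD) !lee_fin /k => h'.
  have := ler_wpM2l (ltW eta0) h'.
  have -> : eta * (6 * (12^-1 + eta^-1 * x)) = eta / 2 + 6 * x by field; rewrite gt_eqF.
  by move=> ?; lra.
have {}h : (k%:E * leb (II n `&` Q n) <= (k * e)%:E)%E.
  apply: (@le_trans _ _ (k%:E * leb A)%E).
    apply: lee_wpmul2l; first by rewrite lee_fin ltW.
    exact: le_lebesgue.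
  apply: le_trans h _; rewrite -lee_pdivlMl// -EFinM.
  by rewrite mulrC; exact: ltW.
by move: h; rewrite (EFinM k e) lee_pmul2l.
Qed.

End generic_lines.

(** * Summability of peripheral diameters along lines *)

Section hits_sum.
Context {R : realType}.
Local Notation leb := (@lebesgue_measure R).
Local Notation realM := (measurableTypeR R).
Local Notation plane := (measurableTypeR R * measurableTypeR R)%type.
Local Notation II n := (`[(- (n%:R : R))%R, (n%:R : R)%R]%classic).
Implicit Type A : set (sphere R).

Lemma sphere_ball_open (x : sphere R) (r : R) : open (ball x r).
Proof.
rewrite openE => y; rewrite ballEmdist /= => xy.
apply/nbhs_ballP; exists (r - mdist x y); first by rewrite /= subr_gt0.
move=> z; rewrite !ballEmdist /= => yz.
by rewrite (le_lt_trans (metric_triangle x y z))// -ltrBrDl.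
Qed.

Lemma diam_has_ubound A : has_ubound [set mdist x y | x in A & y in A].
Proof.
by exists pi => r [x Ax [y Ay <-]]; have /andP[] := mdist_itv x y.
Qed.

Lemma mdist_le_diam A x y : A x -> A y -> mdist x y <= diam A.
Proof. by move=> Ax Ay; apply: ub_le_sup; [exact: diam_has_ubound|exists x => //; exists y]. Qed.

Lemma diam_ge0 A : 0 <= diam A.
Proof.
have [[x Ax]|A0] := pselect (A !=set0).
  by rewrite -(mdistxx x) mdist_le_diam.
rewrite /diam (_ : [set _ | _ in _ & _ in _] = set0) ?sup0//.
by apply/seteqP; split => // r [x Ax]; exfalso; apply: A0; exists x.
Qed.

Lemma diam_adherent A (e : R) : A !=set0 -> 0 < e ->
  exists x y, [/\ A x, A y & diam A - e < mdist x y].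
Proof.
move=> [x Ax] e0; have : has_sup [set mdist x y | x in A & y in A].
  by split; [exists (mdist x x), x => //; exists x|exact: diam_has_ubound].
by move=> /(sup_adherent e0)[r [y Ay [z Az <-]] h]; exists y, z.
Qed.

(** Two points of A more than half the diameter apart show that the ball of radius diam A / 2 about
    one of them does not contain A, so that fatness applies to this ball. *)
Lemma fat_measure_ge (tau : R) A : A !=set0 -> fat tau A ->
  ((tau * (diam A / 2) ^+ 2)%:E <= sphere_measure A)%E.
Proof.
move=> A0 [mA fatA]; have := diam_ge0 A; rewrite le_eqVlt => /predU1P[<-|dA].
  by rewrite mul0r expr0n mulr0 measure_ge0.
have d2 : 0 < diam A / 2 by rewrite divr_gt0.
have [x [y [Ax Ay xy]]] := diam_adherent A0 d2.
apply: (@le_trans _ _ (sphere_measure (ball x (diam A / 2) `&` A))).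
  apply: fatA => // /(_ y Ay); rewrite ballEmdist /= => yx.
  by move: xy; rewrite ltNge => /negP; apply; lra.
have mB : measurable (ball x (diam A / 2) `&` A).
  apply: measurableI => //; apply: sub_sigma_algebra; exact: sphere_ball_open.
by apply: le_measure; rewrite ?inE//; exact: subIsetr.
Qed.

(** The density is at most 4 / ((1 + x ^+ 2) * (1 + y ^+ 2)), a product with integral 4 * pi ^+
    2. *)
Lemma sphere_measure_fin : (sphere_measure [set: sphere R] < +oo)%E.
Proof.
pose w (x : R) : R := (oneDsqr x)^-1.
have w0 x : 0 <= w x by rewrite invr_ge0 (le_trans ler01).
have wc : continuous w := @continuous_oneDsqrV R.
have mw : measurable_fun [set: realM] (fun x => (w x)%:E).
  by apply/measurable_EFinP; exact: continuous_measurable_fun.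
have wint : (\int[leb]_x (w x)%:E = pi%:E)%E.
  rewrite ge0_symfun_integralT//; last by move=> x; rewrite /w /oneDsqr /= sqrrN.
  rewrite (_ : [set x | _] = `[0, +oo[%classic); last first.
    by apply/seteqP; split => x/=; rewrite in_itv/= andbT.
  by rewrite integral0y_oneDsqr -EFinM mulrC divfK.
rewrite /sphere_measure preimage_setT.
pose F (z : plane) : \bar R := ((4 * w z.1) * w z.2)%:E.
have mF : measurable_fun [set: plane] F.
  apply/measurable_EFinP; apply: measurable_funM; last first.
    apply: (measurableT_comp (f := (w : realM -> realM))); last exact: measurable_snd.
    exact: continuous_measurable_fun.
  apply: measurable_funM; first exact: measurable_cst.
  apply: (measurableT_comp (f := (w : realM -> realM))); last exact: measurable_fst.
  exact: continuous_measurable_fun.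
have F0 z : (0 <= F z)%E by rewrite lee_fin !mulr_ge0.
have prod_le (a b : R) : 0 <= a -> 0 <= b -> (1 + a) * (1 + b) <= (1 + a + b) ^+ 2.
  by move=> a0 b0; have := mulr_ge0 a0 b0; have := sqr_ge0 a; have := sqr_ge0 b; lra.
have sF : (\int[(lebesgue_measure \x lebesgue_measure)%E]_z sphere_density z <=
  \int[(lebesgue_measure \x lebesgue_measure)%E]_z F z)%E.
  apply: ge0_le_integral => //.
  - by move=> z _; exact: sphere_density_ge0.
  - exact: measurable_sphere_density.
  - move=> [x y] _; rewrite /F /w /= lee_fin /sphere_density /= -mulrA -invfM.
    rewrite ler_pM2l// lef_pV2 ?posrE ?mulr_gt0 ?exprn_gt0 ?stereo_den_gt0//.
    by apply: prod_le; exact: sqr_ge0.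
apply: le_lt_trans sF _; rewrite fubini_tonelli1//.
have E x : fubini_F leb F x = ((4 * pi)%:E * (w x)%:E)%E.
  rewrite /fubini_F /F /=; under eq_integral do rewrite EFinM.
  rewrite ge0_integralZl//; last by rewrite lee_fin mulr_ge0.
    by rewrite wint -!EFinM mulrAC.
  by move=> y _; rewrite lee_fin.
under eq_integral do rewrite E.
rewrite ge0_integralZl//.
- by rewrite wint -EFinM ltry.
- by move=> y _; rewrite lee_fin.
- by rewrite lee_fin mulr_ge0// pi_ge0.
Qed.

Lemma sphere_hausdorff : hausdorff_space (sphere R).
Proof.
move=> x y xy; apply: mdist_positivity; apply/eqP; rewrite eq_le mdist_ge0 andbT.
apply/ler_addgt0Pr => e e0; rewrite add0r.
have e2 : 0 < e / 2 by rewrite divr_gt0.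
have [z [/= xz yz]] := xy _ _ (nbhsx_ballx x _ e2) (nbhsx_ballx y _ e2).
rewrite !ballEmdist /= in xz yz.
by rewrite (le_trans (metric_triangle x z y))// (metric_sym z); lra.
Qed.

Lemma compact_sphere_measurable A : compact A -> measurable A.
Proof.
move=> cA; rewrite -(setCK A); apply: measurableC; apply: sub_sigma_algebra.
by apply: closed_openC; apply: compact_closed => //; exact: sphere_hausdorff.
Qed.

(** The squared diameters are at most 4 / tau times the areas, and the peripheral continua are
    disjoint subsets of a sphere of finite area. *)
Lemma fat_diam_summable (X : sierpinski_packing R) (tau : R) : 0 < tau ->
  (forall i, (closed_jordan_region (periph X i) /\ fat tau (periph X i)) \/
    exists x, periph X i = [set x]) ->
  (\sum_(i <oo) ((diam (periph X i)) ^+ 2)%:E < +oo)%E.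
Proof.
move=> tau0 Xfat.
have le_meas i : (((diam (periph X i)) ^+ 2)%:E <= (4 / tau)%:E * sphere_measure (periph X i))%E.
  have [[_ fi]|[x ->]] := Xfat i.
    have [ne _ _] := periph_continuum X i.
    have := fat_measure_ge ne fi.
    rewrite -lee_pdivrMl ?divr_gt0// -EFinM => /(le_trans _); apply.
    by rewrite lee_fin invf_div expr_div_n; lra.
  rewrite (_ : diam [set x] = 0); first by rewrite expr0n mule_ge0// lee_fin divr_ge0// ltW.
  rewrite /diam (_ : [set _ | _ in _ & _ in _] = [set 0]) ?sup1//.
  apply/seteqP; split => [r [y -> [z -> <-]]|r ->] /=; first by rewrite mdistxx.
  by exists x => //; exists x => //; rewrite mdistxx.
apply: (@le_lt_trans _ _ (\sum_(i <oo) (4 / tau)%:E * sphere_measure (periph X i))%E).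
  by apply: lee_nneseries => [i _ _|i _//]; rewrite lee_fin sqr_ge0.
rewrite nneseriesZl; last by move=> i _; exact: measure_ge0.
rewrite (_ : (\sum_(i <oo) _)%E = sphere_measure (\bigcup_i periph X i)).
  apply: (@le_lt_trans _ _ ((4 / tau)%:E * sphere_measure [set: sphere R])%E).
    apply: lee_wpmul2l; first by rewrite lee_fin divr_ge0// ltW.
    apply: le_measure; rewrite ?inE//; apply: bigcup_measurable => i _.
    by apply: compact_sphere_measurable; have [] := periph_continuum X i.
  have := sphere_measure_fin; rewrite -ge0_fin_numE// => /fineK <-.
  by rewrite -EFinM ltry.
rewrite measure_bigcup//=; last 2 first.
- by move=> i _; apply: compact_sphere_measurable; have [] := periph_continuum X i.
- exact: periph_trivIset.
by apply: eq_eseriesl => i; rewrite in_setT.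
Qed.

(** Within a square, the lines that hit [p j] have their parameter c in an interval of length
    comparable to [diam (p j)]. Integrating the sum over c thus gives at most a multiple of the sum
    of the [d j * diam (p j)], finite since both sequences are square summable. *)
Lemma hits_sum_finite (v : bool) (p : nat -> set (sphere R)) (d : nat -> R) :
  (forall j, 0 <= d j) -> (\sum_(j <oo) ((d j) ^+ 2)%:E < +oo)%E ->
  (\sum_(j <oo) ((diam (p j)) ^+ 2)%:E < +oo)%E ->
  leb [set c | exists n : nat,
    \esum_(j in [set j | p j `&` line v c @` II n !=set0]) (d j)%:E = +oo]%E = 0%E.
Proof.
move=> d0 dfin pfin.
pose Q (n : nat) : set R := [set c |
  \esum_(j in [set j | p j `&` line v c @` II n !=set0]) (d j)%:E = +oo]%E.
apply: (@lebesgue_sub_eq0 _ _ (\bigcup_n Q n)) => [c [n cn]|]; first by exists n.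
apply: exhaust_eq0 => [n|m n mn c Qc]; last first.
  apply/eqP; rewrite -leye_eq -Qc; apply: ereal_sup_le => _ [F [fF FI] <-].
  exists F => //; split => // j /FI.
  move=> [x [pjx [s sm sx]]]; exists x; split => //; exists s => //.
  move: sm; rewrite /= !in_itv /= -!ler_norml => /le_trans; apply.
  by rewrite ler_nat.
pose M : R := n%:R; pose B : R := 1 + 2 * M ^+ 2.
have B0 : 0 <= B by have := sqr_ge0 M; rewrite /B; lra.
pose P j : set R := [set c | `|c| <= M /\ p j `&` line v c @` II n !=set0].
(* Any line that hits [p j] in the square can serve as the centre [c0]; B is the factor of
   [coord_le_mdist], uniform on that square. *)
have /choice[c0 c0P] : forall j, exists c0, forall c, P j c -> `|c - c0| <= B * diam (p j).
  move=> j; have [[c0 [c0M [x0 [px0 [s0 s0M E0]]]]]|NP] := pselect (P j !=set0); last first.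
    by exists 0 => c Pc; exfalso; apply: NP; exists c.
  rewrite -{}E0 in px0.
  exists c0 => c [cM [x [px [s sM E]]]]; rewrite -{}E in px.
  rewrite /= !in_itv /= -!ler_norml in s0M sM.
  have := mdist_le_diam px px0 => h.
  apply: le_trans (ler_wpM2l B0 h); rewrite /line /axis.
  by case: (v) px px0 h => px px0 h;
    [have [+ _] := @coord_le_mdist _ M (c, s) (c0, s0) cM sM c0M s0M
    |have [_ +] := @coord_le_mdist _ M (s, c) (s0, c0) sM cM s0M c0M].
pose J j : set realM := `[c0 j - B * diam (p j), c0 j + B * diam (p j)]%classic.
have mJ j : measurable (J j) by exact: measurable_itv.
pose f j (c : realM) : \bar R := (d j * \1_(J j) c)%:E.
have f0 j c : (0 <= f j c)%E by rewrite lee_fin mulr_ge0.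
have mf j : measurable_fun [set: realM] (f j).
  by apply/measurable_EFinP; apply: measurable_funM => //; exact: measurable_indic.
pose S c := (\sum_(j <oo) f j c)%E.
have intf j : (\int[leb]_c f j c <= B%:E * (((d j) ^+ 2)%:E + ((diam (p j)) ^+ 2)%:E))%E.
  rewrite /f; under eq_integral do rewrite EFinM.
  rewrite ge0_integralZl//; last 2 first.
  - by apply/measurable_EFinP; exact: measurable_indic.
  - by rewrite lee_fin.
  rewrite integral_indic// setIT /= lebesgue_measure_itv /=.
  have h : 0 <= B * diam (p j) by rewrite mulr_ge0 ?diam_ge0.
  have dd : d j * (2 * diam (p j)) <= d j ^+ 2 + diam (p j) ^+ 2.
    by have := sqr_ge0 (d j - diam (p j)); lra.
  case: ifP => _; last first.
    by rewrite mule0 -EFinD -EFinM lee_fin mulr_ge0// addr_ge0 ?sqr_ge0.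
  rewrite -EFinB -EFinD -!EFinM lee_fin.
  by have := ler_wpM2l B0 dd; lra.
have mS : measurable_fun [set: realM] S.
  by apply: (@ge0_emeasurable_sum _ _ _ _ f xpredT).
have intS : (\int[leb]_c S c < +oo)%E.
  rewrite /S integral_nneseries//.
  apply: (@le_lt_trans _ _ (\sum_(j <oo) B%:E * (((d j) ^+ 2)%:E + ((diam (p j)) ^+ 2)%:E))%E).
    by apply: lee_nneseries => [j _ _|j _]; [exact: integral_ge0|exact: intf].
  rewrite nneseriesZl; last by move=> j _; rewrite adde_ge0// lee_fin sqr_ge0.
  rewrite nneseriesD; try by move=> j _ _; rewrite lee_fin sqr_ge0.
  rewrite lte_mul_pinfty ?lee_fin//.
  exact: lte_add_pinfty.
have S0 c : (0 <= S c)%E by apply: nneseries_ge0.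
have iS : leb.-integrable [set: realM] S.
  apply/integrableP; split => //; apply: le_lt_trans intS.
  by under eq_integral do rewrite gee0_abs//.
have [N [mN N0 NS]] := integrable_ae measurableT iS.
apply: (lebesgue_sub_eq0 _ N0) => c [cM Qc]; apply: NS => /= /(_ I).
rewrite ge0_fin_numE// ltNge => /negP; apply; rewrite -Qc.
rewrite esum_mkcond -nneseries_esumT; last by move=> j; case: ifP; rewrite // lee_fin.
apply: lee_nneseries => [j _ _|j _]; first by case: ifP; rewrite // lee_fin.
case: ifPn => [|_]; last exact: f0.
rewrite inE => hj; rewrite /f lee_fin indicE mem_set ?mulr1// /J /= in_itv /=.
rewrite -ler_distl; apply: c0P; split => //.
by move: cM; rewrite /= in_itv /= -ler_norml.
Qed.

End hits_sum.

(** * Images of generic lines and rectangles *)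

Section good_lines.
Context {R : realType}.
Local Notation leb := (@lebesgue_measure R).
Local Notation realM := (measurableTypeR R).
Local Notation II n := (`[(- (n%:R : R))%R, (n%:R : R)%R]%classic).

Lemma density_measure (F : realM -> \bar R) :
  measurable_fun [set: realM] F -> (forall x, (0 <= F x)%E) ->
  exists nu : {measure set realM -> \bar R},
    forall A, nu A = (\int[leb]_(x in A) F x)%E.
Proof.
move=> mF F0; pose m (A : set realM) := (\int[leb]_(x in A) F x)%E.
have m0 : m set0 = 0%E by rewrite /m integral_set0.
have mge0 A : (0 <= m A)%E by apply: integral_ge0.
have madd : semi_sigma_additive m := semi_sigma_additive_nng_induced mF F0.
pose mm := isMeasure.Build _ realM R m m0 mge0 madd.
pose nu : {measure set realM -> \bar R} := HB.pack m mm.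
by exists nu.
Qed.

Lemma lebesgue_compact_le (J : set R) (d : R) : 0 <= d -> compact J ->
  (forall x y, J x -> J y -> `|x - y| <= d) -> (leb J <= d%:E)%E.
Proof.
move=> d0 cJ Jd; have [J0|] := pselect (J !=set0); last first.
  move=> /set0P/negP/negPn/eqP ->; by rewrite measure0 lee_fin.
have [m Jm mle] := compact_min J0 cJ; have [M JM leM] := compact_max J0 cJ.
apply: (@le_trans _ _ (leb `[m, M])).
  apply: le_lebesgue => x Jx.
  by rewrite /= in_itv /= mle// leM.
rewrite lebesgue_measure_itv /=; case: ifP => _; last by rewrite lee_fin.
by rewrite -EFinB lee_fin (le_trans (ler_norm _))// Jd.
Qed.

Lemma mdist_lip (x y w : sphere R) : `|mdist x w - mdist y w| <= mdist x y.
Proof.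
have h1 := metric_triangle x y w; have h2 := metric_triangle y x w.
by rewrite ler_distl; rewrite (metric_sym y x) in h2; apply/andP; split; lra.
Qed.

Lemma mdist_continuous (w : sphere R) : continuous (fun x : sphere R => mdist x w).
Proof.
move=> x; apply/(@cvg_ballP _ _ _ (nbhs x)) => e e0.
have : nbhs x (ball x e) by exact: nbhsx_ballx.
apply: filterS => y; rewrite ballEmdist /= /ball /=.
by apply: le_lt_trans; exact: mdist_lip.
Qed.

Variables (X Y : sierpinski_packing R) (H : sphere R -> sphere R).
Variables (rhoH : sphere R -> \bar R) (Gamma0 : set (curve R)) (i : nat).
Variables (w0 : sphere R).
Hypothesis H_cont : continuous H.
Hypothesis H_periph : forall j x, periph X j x -> periph Y j (H x).
Hypothesis rho_borel : nonneg_borel rhoH.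
Hypothesis H_curves : forall g : curve R, ~ Gamma0 g ->
  ((mdist (H (g (curve_start g))) (H (g (curve_end g))))%:E <=
    line_integral g rhoH + diam_sum X Y g)%E.

Local Notation Q := (H @^-1` periph Y i).

(** All segments of the line are covered at once, so that one null set of parameters c serves every
    subsegment to which the upper gradient inequality is later applied. *)
Definition good_line (v : bool) (c : R) :=
  [/\ forall n : nat, (\int[leb]_(s in II n) (rhoH (line v c s) ^+ 2) < +oo)%E,
      forall n : nat, (\int[leb]_(s in II n) (rhoH \_ Q) (line v c s) = 0)%E,
      forall s t (st : s <= t), ~ Gamma0 (segment v c st) &
      forall n : nat, (\esum_(j in [set j | periph X j `&` line v c @` II n !=set0])
        (diam (periph Y j))%:E < +oo)%E].

Lemma periph_closed (Z : sierpinski_packing R) j : closed (periph Z j).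
Proof.
by apply: compact_closed; [exact: sphere_hausdorff|have [] := periph_continuum Z j].
Qed.

Lemma Q_closed : closed Q.
Proof. by apply: closed_comp; [move=> x _; exact: H_cont|exact: periph_closed]. Qed.

Lemma Q_measurable : measurable Q.
Proof.
rewrite -(setCK Q); apply: measurableC; apply: sub_sigma_algebra.
exact/closed_openC/Q_closed.
Qed.

Lemma good_line_image0 v c s t : good_line v c -> s <= t ->
  (forall r, s <= r <= t -> ~ periph X i (line v c r)) ->
  leb ((fun r => mdist (H (line v c r)) w0) @`
       ((line v c @^-1` Q) `&` `[s, t])) = 0%E.
Proof.
move=> [G1 G2 G3 G4] st avoid.
have lc := @line_continuous R v c.
pose f r := mdist (H (line v c r)) w0.
have fc : continuous f.
  move=> r; apply: (continuous_comp (g := fun x => mdist x w0)); last exact: mdist_continuous.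
  by apply: continuous_comp; [exact: lc|exact: H_cont].
have [n [sn tn]] : exists n : nat, - n%:R <= s /\ t <= n%:R.
  exists (Num.truncn (`|s| + `|t|)).+1.
  have := truncnS_gt (`|s| + `|t|); have := ler_norm t.
  have := ler_norm (- s); rewrite normrN; have := normr_ge0 s; have := normr_ge0 t.
  by split; lra.
have stn : `[s, t] `<=` II n.
  by move=> x /=; rewrite !in_itv /= => /andP[? ?]; apply/andP; split; lra.
(* The factor 6 turns the parameter integral into a bound for the arclength integral, by
   [segment_integral_le]. *)
pose F r := (6%:E * rhoH (line v c r))%E.
have [mrho rho0] := rho_borel.
have mrl A : measurable_fun (A : set realM) (rhoH \o line v c) by exact: measurable_line.
have mF : measurable_fun [set: realM] F by apply: measurable_funeM; exact: mrl.
have F0 r : (0 <= F r)%E by rewrite mule_ge0// lee_fin.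
have [nu nuE] := density_measure mF F0.
have nuZ A : measurable (A : set realM) -> nu A = (6%:E * \int[leb]_(r in A) rhoH (line v c r))%E.
  by move=> mA; rewrite nuE /F ge0_integralZl//; exact: mrl.
pose T j := line v c @^-1` (periph X j) `&` `[s, t].
pose hit j := `[< T j !=set0 >].
pose J j := if hit j then (fun w => mdist w w0) @` periph Y j else set0.
(* Only the continua met by the segment are charged: the diameters of all q_j are merely square
   summable, but those met by a good line are summable. *)
pose d j := if hit j then diam (periph Y j) else 0.
have d0 j : 0 <= d j by rewrite /d; case: ifP => // _; exact: diam_ge0.
have dfin : (\sum_(j <oo) (d j)%:E < +oo)%E.
  rewrite nneseries_esumT; last by move=> j; rewrite lee_fin.
  apply: le_lt_trans (G4 n); rewrite [leRHS]esum_mkcond; apply: le_esum => j _.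
  rewrite /d /hit; case: asboolP => [[r [/= pr rst]]|_]; last by case: ifP; rewrite // lee_fin diam_ge0.
  rewrite ifT// inE; exists (line v c r); split => //; exists r => //; exact: stn.
have Tcl j : closed (T j).
  apply: closedI; last exact: interval_closed.
  by apply: closed_comp; [move=> r _; exact: lc|exact: periph_closed].
have cC : closed (line v c @^-1` Q).
  apply: (@closed_comp _ _ (H \o line v c)); last exact: periph_closed.
  by move=> r _; apply: continuous_comp; [exact: lc|exact: H_cont].
have Jcomp j : compact ((fun w : sphere R => mdist w w0) @` periph Y j).
  apply: continuous_compact; first by apply: continuous_subspaceT; exact: mdist_continuous.
  by have [] := periph_continuum Y j.
apply: (@measure_image_avoiding0 R f nu d fc d0 dfin T J) => //.
- move=> j; rewrite /J; case: ifP => _; last by move=> x y [].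
  apply/connected_intervalP; apply: connected_continuous_connected.
    by have [] := periph_continuum Y j.
  by apply: continuous_subspaceT; exact: mdist_continuous.
- move=> j; rewrite /J /d; case: ifP => _; last by rewrite measure0.
  apply: lebesgue_compact_le => //; first exact: diam_ge0.
  move=> _ _ [x Yx <-] [y Yy <-]; apply: le_trans (mdist_lip _ _ _) _.
  exact: mdist_le_diam.
- move=> j r Tr; rewrite /J ifT; last by apply/asboolP; exists r.
  by exists (H (line v c r)) => //; apply: H_periph; case: Tr.
- move=> x y sx xy yt; have xyst : `[x, y] `<=` `[s, t].
    by move=> r /=; rewrite !in_itv /= => /andP[? ?]; apply/andP; split; lra.
  have := H_curves (G3 x y xy); rewrite /= => hxy.
  apply: (@le_trans _ _ (mdist (H (line v c x)) (H (line v c y)))%:E).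
    by rewrite lee_fin; exact: mdist_lip.
  apply: le_trans hxy _; apply: leeD.
    apply: le_trans (segment_integral_le v c xy rho_borel) _.
    rewrite nuZ//; apply: lee_wpmul2l; first by rewrite lee_fin.
    rewrite integral_itv_bndo_bndc; last exact: mrl.
    by rewrite integral_itv_obnd_cbnd//; exact: mrl.
  rewrite /diam_sum (_ : [set j | _] = hits T x y); last first.
    apply/seteqP; split=> j [z].
      move=> [pz [r rxy rz]]; exists r; split => //; split; last exact: xyst.
      by move: pz; rewrite -rz.
    by move=> [[pz _] zxy]; exists (line v c z); split => //; exists z.
  apply: le_esum => j [z [Tz _]]; rewrite /d ifT//.
  by apply/asboolP; exists z.
- rewrite nuZ//; apply: lte_mul_pinfty; rewrite ?lee_fin//.
  have mI : measurable (II n : set realM) by exact: measurable_itv.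
  have msq : measurable_fun (II n : set realM) (fun r => rhoH (line v c r) ^+ 2)%E.
    exact: (@measurable_line R v c _ (II n) (nonneg_borel_sqr rho_borel).1).
  apply: (@le_lt_trans _ _ (\int[leb]_(r in II n) (1%:E + 1^-1%:E * rhoH (line v c r) ^+ 2))%E).
    apply: (@le_trans _ _ (\int[leb]_(r in II n) rhoH (line v c r))%E).
      by apply: (@ge0_subset_integral _ realM).
    apply: ge0_le_integral => //.
      by apply: emeasurable_funD; [exact: measurable_cst|exact: measurable_funeM].
    by move=> r _; exact: le_add_sqr.
  rewrite invr1; under eq_integral do rewrite mul1e.
  rewrite ge0_integralD//; last by move=> r _; exact: sqre_ge0.
  apply: lte_add_pinfty; last exact: G1.
  rewrite integral_cst//= lebesgue_measure_itv /=.
  by case: ifP => _; rewrite ?mule0// -EFinB -EFinM ltry.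
(* A common point would be sent by H into both q_i and q_j; disjointness forces j = i, and the
   segment avoids p_i. *)
- move=> j; apply/seteqP; split => // r [/= Qr [pr /=]]; rewrite in_itv /= => rst.
  have ij : i = j.
    apply: (@periph_trivIset _ Y) => //; exists (H (line v c r)); split => //.
    exact: H_periph.
  by apply: (avoid r rst); rewrite ij.
- have mCst : measurable (line v c @^-1` Q `&` `[s, t] : set realM).
    by apply: measurableI => //; exact: closed_measurable.
  rewrite nuZ// (_ : (\int[leb]_(r in _) _)%E = 0%E) ?mule0//.
  apply/eqP; rewrite eq_le integral_ge0// andbT -[leRHS](G2 n) setIC integral_mkcondr.
  have -> : (rhoH \o line v c) \_ (line v c @^-1` Q) = (rhoH \_ Q) \o line v c.
    by [].
  apply: (@ge0_subset_integral _ realM) => //.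
  - apply: measurable_line.
    exact: (measurable_restrictT rhoH Q_measurable).1 (measurable_funTS mrho).
  - by move=> r _; apply: erestrict_ge0.
Qed.

End good_lines.

(** * Rectangles with generic sides *)

Section generic_boxes.
Context {R : realType}.
Local Notation leb := (@lebesgue_measure R).

Lemma lebesgue_setU_eq0 (A B : set R) : leb A = 0%E -> leb B = 0%E ->
  leb (A `|` B) = 0%E.
Proof.
move=> A0 B0; apply/eqP; rewrite -measure_le0.
have := @outer_measureU2 _ _ (((wlength (@idfun R))^*)%mu) A B.
by move=> /le_trans; apply; rewrite -[X in (X + _)%E]/(leb A) -[X in (_ + X)%E]/(leb B) A0 B0 adde0.
Qed.

Lemma sqr_integral_eq0 (rho : sphere R -> \bar R) (Q : set (sphere R)) :
  measurable Q -> nonneg_borel rho ->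
  (\int[@sphere_measure R]_(x in Q) (rho x ^+ 2) = 0)%E ->
  (\int[@sphere_measure R]_x (rho \_ Q) x = 0)%E.
Proof.
move=> mQ rhob r0; have [mrho rho0] := rhob; have [mr2 r20] := nonneg_borel_sqr rhob.
rewrite -integral_mkcond.
have : (\int[@sphere_measure R]_(x in Q) `|rho x ^+ 2| = 0)%E.
  by rewrite -[RHS]r0; apply: eq_integral => x _; rewrite gee0_abs.
move=> /(ae_eq_integral_abs _ mQ (measurable_funTS mr2)) ae0.
rewrite (@ae_eq_integral _ _ _ _ Q (cst 0%E)) ?integral0//; first exact: measurable_funTS.
apply: filterS ae0 => x h Qx; have /eqP := h Qx.
by rewrite expe2 mule_eq0 orbb => /eqP.
Qed.

Variables (X Y : sierpinski_packing R) (H : sphere R -> sphere R).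
Variables (rhoH : sphere R -> \bar R) (Gamma0 : set (curve R)) (i : nat).
Variables (w0 : sphere R).
Hypothesis H_cont : continuous H.
Hypothesis H_periph : forall j x, periph X j x -> periph Y j (H x).
Hypothesis rho_L2 : nonneg_borel_L2 rhoH.
Hypothesis H_curves : forall g : curve R, ~ Gamma0 g ->
  ((mdist (H (g (curve_start g))) (H (g (curve_end g))))%:E <=
    line_integral g rhoH + diam_sum X Y g)%E.
Hypothesis Gamma0_exceptional : modulus2 Gamma0 = 0%E.
Hypothesis X_diam : (\sum_(j <oo) ((diam (periph X j)) ^+ 2)%:E < +oo)%E.
Hypothesis Y_diam : (\sum_(j <oo) ((diam (periph Y j)) ^+ 2)%:E < +oo)%E.
Local Notation Q := (H @^-1` periph Y i).
Hypothesis rho_Q : (\int[@sphere_measure R]_(x in Q) (rhoH x ^+ 2) = 0)%E.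

Local Notation good := (good_line X Y H rhoH Gamma0 i).

Lemma not_good_line_eq0 v : leb [set c | ~ good v c] = 0%E.
Proof.
have [rho_borel rho_fin] := rho_L2.
have mQ : measurable Q by exact: Q_measurable.
have QF : nonneg_borel (rhoH \_ Q).
  have [mrho rho0] := rho_borel; split; last by move=> x; apply: erestrict_ge0.
  exact: (measurable_restrictT rhoH mQ).1 (measurable_funTS mrho).
have A1 := line_integral_finite v (nonneg_borel_sqr rho_borel) rho_fin.
have A2 := line_integral_zero v QF (sqr_integral_eq0 mQ rho_borel rho_Q).
have A3 := modulus0_lines v Gamma0_exceptional.
have A4 := hits_sum_finite v (fun j => diam_ge0 (periph Y j)) Y_diam X_diam.
apply: lebesgue_sub_eq0 (lebesgue_setU_eq0 (lebesgue_setU_eq0 A1 A2) (lebesgue_setU_eq0 A3 A4)).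
move=> c bad; apply: contrapT => nU; apply: bad; split.
- move=> n; rewrite ltNge leye_eq; apply/eqP => h; apply: nU; left; left.
  by exists n.
- move=> n; apply/eqP; rewrite eq_le integral_ge0 ?andbT; last by move=> s _; have [_] := QF; apply.
  by rewrite leNgt; apply/negP => h; apply: nU; left; right; exists n.
- by move=> s t st G; apply: nU; right; left; exists s, t, st.
- move=> n; rewrite ltNge leye_eq; apply/eqP => h; apply: nU; right; right.
  by exists n.
Qed.

Lemma good_line_between v (a b : R) : a < b -> exists c, a < c < b /\ good v c.
Proof.
move=> ab; apply: contrapT => no.
have sub : `]a, b[ `<=` [set c | ~ good v c].
  by move=> c /=; rewrite in_itv /= => cab gc; apply: no; exists c.
have := lebesgue_sub_eq0 sub (not_good_line_eq0 v).
rewrite lebesgue_measure_itv /= lte_fin ab -EFinB => -[] /eqP.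
by rewrite subr_eq0 gt_eqF.
Qed.

Hypothesis H_mono : monotone_map H.
Hypothesis q_sub : periph Y i `<=` H @` periph X i.

Lemma box_image_eq0 (x0 y0 r : R) (E : set (sphere R)) : 0 < r -> E `<=` Q ->
  (forall x y, x0 - 2 * r <= x <= x0 + 2 * r -> y0 - 2 * r <= y <= y0 + 2 * r ->
    ~ periph X i (Some (x, y))) ->
  leb ((fun x => mdist (H x) w0) @` (E `&` [set x | exists a b,
    [/\ x = Some (a, b), `|a - x0| < r & `|b - y0| < r]])) = 0%E.
Proof.
move=> r0 EQ avoid.
(* The sides are placed at distances between r and 2 * r from the centre: the rectangle then
   contains the small box and is itself contained in the large one, which misses p_i. *)
have [a1 [/andP[a1l a1r] ga1]] := @good_line_between true (x0 - 2 * r) (x0 - r) ltac:(lra).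
have [a2 [/andP[a2l a2r] ga2]] := @good_line_between true (x0 + r) (x0 + 2 * r) ltac:(lra).
have [b1 [/andP[b1l b1r] gb1]] := @good_line_between false (y0 - 2 * r) (y0 - r) ltac:(lra).
have [b2 [/andP[b2l b2r] gb2]] := @good_line_between false (y0 + r) (y0 + 2 * r) ltac:(lra).
have a12 : a1 <= a2 by lra.
have b12 : b1 <= b2 by lra.
pose side v c s t := (fun u => mdist (H (line v c u)) w0) @` ((line v c @^-1` Q) `&` `[s, t]).
have side0 v c s t : good v c -> s <= t ->
    (forall u, s <= u <= t -> ~ periph X i (line v c u)) -> leb (side v c s t) = 0%E.
  move=> gc st av; exact: (good_line_image0 w0 H_cont H_periph rho_L2.1 H_curves gc st av).
have S1 : leb (side true a1 b1 b2) = 0%E.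
  by apply: side0 => // u /andP[? ?]; apply: avoid; apply/andP; split; lra.
have S2 : leb (side true a2 b1 b2) = 0%E.
  by apply: side0 => // u /andP[? ?]; apply: avoid; apply/andP; split; lra.
have S3 : leb (side false b1 a1 a2) = 0%E.
  by apply: side0 => // u /andP[? ?]; apply: avoid; apply/andP; split; lra.
have S4 : leb (side false b2 a1 a2) = 0%E.
  by apply: side0 => // u /andP[? ?]; apply: avoid; apply/andP; split; lra.
apply: lebesgue_sub_eq0 (lebesgue_setU_eq0 (lebesgue_setU_eq0 S1 S2) (lebesgue_setU_eq0 S3 S4)).
move=> w [x [Ex [a [b [xE ax bx]]]] <-{w}].
have [[u ub]|nu] := pselect (exists u, (line true a1 @` `[b1, b2] `|` line true a2 @` `[b1, b2] `|`
    (line false b1 @` `[a1, a2] `|` line false b2 @` `[a1, a2])) u /\ H u = H x).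
  have Qu : Q u by case: ub => _ /= ->; exact: EQ.
  case: ub => ub Hu; rewrite -Hu.
  case: ub => -[[t tb tu]|[t tb tu]]; [left; left|left; right|right; left|right; right];
    by exists t; rewrite ?tu//; split => //=; rewrite tu.
exfalso; have [p pi Hp] := q_sub (EQ _ Ex).
have [_ _ cF] := H_mono (H x).
pose O : set (R * R) := `]a1, a2[%classic `*` `]b1, b2[%classic.
pose K : set (R * R) := `[a1, a2]%classic `*` `[b1, b2]%classic.
have oO : open (Some @` O : set (sphere R)).
  apply: Some_open; rewrite (_ : O = fst @^-1` `]a1, a2[%classic `&` snd @^-1` `]b1, b2[%classic)//.
  by apply: openI; apply: open_comp; rewrite ?interval_open// => z _; [exact: cvg_fst|exact: cvg_snd].
have cK : closed (Some @` K : set (sphere R)).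
  apply: compact_closed; first exact: sphere_hausdorff.
  apply: continuous_compact; first by apply: continuous_subspaceT; exact: Some_continuous.
  by apply: compact_setX; exact: segment_compact.
have pK : ~ (Some @` K : set (sphere R)) p.
  move=> [[u v] [/=]]; rewrite !in_itv /= => /andP[? ?] /andP[? ?] uvp.
  by apply: (avoid u v); rewrite ?uvp//; apply/andP; split; lra.
have xO : (Some @` O : set (sphere R)) x.
  exists (a, b) => //; move: ax bx; rewrite !ltr_distl => /andP[? ?] /andP[? ?].
  by split; rewrite /= in_itv /=; apply/andP; split; lra.
have OK u : H u = H x -> (Some @` K : set (sphere R)) u -> (Some @` O : set (sphere R)) u.
  move=> Hu [[s t] [/= sa tb] stu]; exists (s, t) => //; apply: contrapT => nO; apply: nu.
  exists u; split => //; move: (sa) (tb); rewrite !in_itv /= => /andP[s1 s2] /andP[t1 t2].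
  have [sa1|sa1] := eqVneq s a1; first by left; left; exists t; rewrite // -stu /line /axis -sa1.
  have [sa2|sa2] := eqVneq s a2; first by left; right; exists t; rewrite // -stu /line /axis -sa2.
  have [tb1|tb1] := eqVneq t b1; first by right; left; exists s; rewrite // -stu /line /axis -tb1.
  have [tb2|tb2] := eqVneq t b2; first by right; right; exists s; rewrite // -stu /line /axis -tb2.
  exfalso; apply: nO; split; rewrite /= in_itv /=.
    by rewrite !lt_neqAle s1 s2 sa2 eq_sym sa1.
  by rewrite !lt_neqAle t1 t2 tb2 eq_sym tb1.
pose F := H @^-1` [set H x].
(* A fibre that misses the four sides meets the open and the closed rectangle in the same set, which
   is thus open and closed in the fibre. By connectedness the fibre would lie inside the rectangle,
   although it contains the point p of p_i. *)
have FE : F `&` Some @` O = F `&` Some @` K.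
  apply/seteqP; split => u [Fu]; last by move=> Ku; split => //; exact: OK.
  move=> [[s t] [/= sa tb] stu]; split => //; exists (s, t) => //.
  move: sa tb; rewrite !in_itv /= => /andP[? ?] /andP[? ?].
  by split; rewrite /= in_itv /= !ltW.
have FOF : F `&` Some @` O = F.
  apply: cF; first by exists x.
    by exists (Some @` O).
  by exists (Some @` K).
apply: pK; suff [] : (F `&` Some @` K) p by [].
by rewrite -FE FOF.
Qed.

End generic_boxes.

(** * The lifted map and the final argument *)

Section lift.
Context {R : realType}.

Lemma packing_proj_eq (Y : sierpinski_packing R) x y :
  packing_proj Y x = packing_proj Y y -> x = y \/ exists j, periph Y j x /\ periph Y j y.
Proof. by move=> /eqmodP /asboolP. Qed.

(** By disjointness, q_j is a full fibre of the projection of Y, so a point whose projection lies in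
    that of q_j belongs to q_j. *)
Lemma lift_periph (X Y : sierpinski_packing R)
    (h : packing_quotient X -> packing_quotient Y) (H : sphere R -> sphere R) j x :
  h @` (packing_proj X @` periph X j) = packing_proj Y @` periph Y j ->
  packing_proj Y \o H = h \o packing_proj X ->
  periph X j x -> periph Y j (H x).
Proof.
move=> hj lift xj.
have : (packing_proj Y @` periph Y j) (packing_proj Y (H x)).
  rewrite -hj; exists (packing_proj X x); first by exists x.
  by have := congr1 (@^~ x) lift.
move=> [y yj /packing_proj_eq[<-//|[k [yk Hk]]]].
by rewrite (@periph_trivIset _ Y j k)//; exists y.
Qed.

(** Surjectivity puts the interior of q in the image of the interior of P. The set q is the closure
    of a region contained in its interior, and the image of the compact set P is closed. *)
Lemma jordan_region_sub_image (P q : set (sphere R)) (H : sphere R -> sphere R) :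
  compact P -> continuous H -> set_surj setT setT H -> H @^-1` q° = P° ->
  closed_jordan_region q -> q `<=` H @` P.
Proof.
move=> cP Hc Hs Hint [U [J [oU _ _ _ qE]]].
have cHP : closed (H @` P).
  apply: compact_closed; first exact: sphere_hausdorff.
  by apply: continuous_compact => //; exact: continuous_subspaceT.
rewrite (closure_id (H @` P)).1// {1}qE; apply: closure_subset => u Uu.
have [x _ xu] := Hs u I; exists x => //; apply: interior_subset.
rewrite -Hint /= xu; suff : U `<=` q° by apply.
by rewrite -open_subsetE// qE; exact: subset_closure.
Qed.

Lemma connected_null_le0 (A : set R) (c : R) : connected A -> A 0 -> A c ->
  lebesgue_measure A = 0%E -> c <= 0.
Proof.
move=> /connected_intervalP iA A0 Ac lA; rewrite leNgt; apply/negP => c0.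
have sub : `[0, c] `<=` A.
  by move=> x /=; rewrite in_itv /= => xc; exact: (iA 0 c).
have := lebesgue_sub_eq0 sub lA; rewrite lebesgue_measure_itv /= lte_fin c0 -EFinB.
by move=> [] /eqP; rewrite subr0 gt_eqF.
Qed.

End lift.

Theorem proposition6p2 (R : realType) (X Y : sierpinski_packing R)
  (p_fat : exists tau : R, 0 < tau /\ forall i,
    (closed_jordan_region (periph X i) /\ fat tau (periph X i)) \/
    exists x, periph X i = [set x])
  (q_jordan : forall i,
    closed_jordan_region (periph Y i) \/ exists y, periph Y i = [set y])
  (q_diam : (\sum_(i <oo) ((diam (periph Y i)) ^+ 2)%:E < +oo)%E)
  (K : R) (K_ge1 : 1 <= K)
  (h : packing_quotient X -> packing_quotient Y)
  (h_qc : packing_quasiconformal K h)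
  (H : sphere R -> sphere R)
  (H_cont : continuous H)
  (H_surj : set_surj setT setT H)
  (H_mono : monotone_map H)
  (H_lift : packing_proj Y \o H = h \o packing_proj X)
  (H_int : forall i, H @^-1` ((periph Y i)°) = (periph X i)°)
  (rhoH : sphere R -> \bar R)
  (rhoH_L2 : nonneg_borel_L2 rhoH)
  (H_curves : exists Gamma0 : set (curve R), modulus2 Gamma0 = 0%E /\
    forall g : curve R, ~ Gamma0 g ->
    ((mdist (H (g (curve_start g))) (H (g (curve_end g))))%:E <=
      line_integral g rhoH + diam_sum X Y g)%E)
  (H_area : forall E : set (sphere R), measurable E ->
    (\int[@sphere_measure R]_(x in H @^-1` E) (rhoH x ^+ 2) <=
      K%:E * sphere_measure (E `&` packing_set Y))%E) :
  forall (i : nat) (E : set (sphere R)), continuum E ->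
    E `<=` H @^-1` (periph Y i) `\` periph X i ->
    exists c, forall x, E x -> H x = c.
Proof.
move=> i E Econt EQ; have [E0 cE connE] := Econt.
have [jordan|[y qy]] := q_jordan i; last first.
  by exists y => x /EQ[]; rewrite /= qy.
have [x0 Ex0] := E0; exists (H x0) => x1 Ex1; apply: contrapT => H10.
have [_ _ _ hperiph _] := h_qc.
have H_periph j x : periph X j x -> periph Y j (H x).
  by apply: lift_periph; [exact: hperiph|exact: H_lift].
have [_ cP _] := periph_continuum X i.
have q_sub := jordan_region_sub_image cP H_cont H_surj (H_int i) jordan.
have [tau [tau0 Xfat]] := p_fat; have X_diam := fat_diam_summable tau0 Xfat.
have [Gamma0 [Gamma0_null Gamma0_curves]] := H_curves.
(* The area inequality is applied to q_i itself, which is disjoint from the packing set Y. *)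
have rho_Q : (\int[@sphere_measure R]_(x in H @^-1` periph Y i) (rhoH x ^+ 2) = 0)%E.
  apply/eqP; rewrite eq_le integral_ge0 ?andbT; last by move=> x _; exact: sqre_ge0.
  have mq : measurable (periph Y i).
    by apply: compact_sphere_measurable; have [] := periph_continuum Y i.
  apply: (le_trans (H_area _ mq)).
  rewrite (_ : _ `&` _ = set0) ?measure0 ?mule0//.
  by apply/seteqP; split => // x [qx]; apply; exists i.
(* Measuring from the value at a point of E makes 0 a value of f on E; if f(E) is a null interval,
   no value can be positive. *)
pose f x := mdist (H x) (H x0).
have f_cont : continuous f.
  move=> x; apply: (continuous_comp (g := fun x => mdist x (H x0))); first exact: H_cont.
  exact: mdist_continuous.
have conn : connected (f @` E).
  by apply: connected_continuous_connected => //; exact: continuous_subspaceT.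
suff fE0 : lebesgue_measure (f @` E) = 0%E.
  have : f x1 <= 0.
    apply: connected_null_le0 conn _ _ fE0; last by exists x1.
    by exists x0; rewrite // /f mdistxx.
  move=> fx1; apply: H10; apply: mdist_positivity; apply/eqP.
  by rewrite eq_le fx1 mdist_ge0.
(* Countably many boxes, with rational centres and radii 1 / (n + 1), suffice; [valid] selects those
   whose double misses p_i. *)
pose rad (k : rat * rat * nat) : R := k.2.+1%:R^-1.
pose box (k : rat * rat * nat) : set (sphere R) := [set x | exists a b,
  [/\ x = Some (a, b), `|a - ratr k.1.1| < rad k & `|b - ratr k.1.2| < rad k]].
pose valid (k : rat * rat * nat) := `[< forall x y,
  ratr k.1.1 - 2 * rad k <= x <= ratr k.1.1 + 2 * rad k ->
  ratr k.1.2 - 2 * rad k <= y <= ratr k.1.2 + 2 * rad k ->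
  ~ periph X i (Some (x, y)) >].
pose F k := if valid k then f @` (E `&` box k) else set0.
have F0 k : lebesgue_measure (F k) = 0%E.
  rewrite /F /valid; case: asboolP => [avoid|_]; last by rewrite measure0.
  apply: (box_image_eq0 (H x0) H_cont H_periph rhoH_L2 Gamma0_curves Gamma0_null
    X_diam q_diam rho_Q H_mono q_sub _ _ avoid).
    by rewrite invr_gt0.
  by move=> x /EQ[].
(* The boxes live in the planar chart; the point at infinity contributes a single value. *)
have None0 : lebesgue_measure [set f None] = 0%E by exact: lebesgue_measure_set1.
apply: lebesgue_sub_eq0 (lebesgue_setU_eq0 None0 (lebesgue_bigcup_eq0 F0)).
move=> _ [[[a b]|] Ex <-]; last by left.
right; have [_ nP] := EQ _ Ex.
have oP : open ((Some : R * R -> sphere R) @^-1` ~` periph X i).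
  apply: open_comp; first by move=> z _; exact: Some_continuous.
  by apply: closed_openC; exact: periph_closed.
have /nbhs_ballP[e /= e0 eP] := open_nbhs_nbhs (conj oP nP).
(* A point of the doubled box differs in each coordinate by less than three radii from a point of
   the box, hence a radius below e / 3. *)
have e3 : 0 < e / 3 by rewrite divr_gt0.
have [n] := ltr_add_invr e3; rewrite add0r => ne.
have n0 : 0 < n.+1%:R^-1 :> R by rewrite invr_gt0.
have rat_near (x : R) : exists q : rat, `|x - ratr q| < n.+1%:R^-1.
  have [|q] := @rat_in_itvoo R (x - n.+1%:R^-1) (x + n.+1%:R^-1).
    by rewrite ltrBlDr -addrA ltrDl addr_gt0.
  by rewrite in_itv /= => qx; exists q; rewrite distrC ltr_distl.
have [p pa] := rat_near a; have [q qb] := rat_near b.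
exists (p, q, n) => //; rewrite /F /valid asboolT; last first.
  move=> x y /=; rewrite /rad /= => xp yq.
  have near_xy : ball (a, b) e (x, y).
    have arith (u v w r d : R) : `|u - v| < r -> v - 2 * r <= w <= v + 2 * r ->
        r < d / 3 -> `|u - w| < d.
      rewrite !ltr_distl => /andP[? ?] /andP[? ?] ?.
      by apply/andP; split; lra.
    by split; [exact: arith pa xp ne|exact: arith qb yq ne].
  exact: eP near_xy.
by exists (Some (a, b)) => //; split => //; exists a, b.
Qed.
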